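(* Let $n\ge1$, $E=\mathbb{C}^n$ and $\Phi,\Psi\in L^\infty_{B(E)}$. Then $H_\Phi T_\Psi$ is a block Hankel operator on the vector-valued Hardy space $H^2_E$ if and only if there exist an invertible complex $n\times n$ matrix $D$ and an integer $0\le l\le n$ such that $$\Phi(z)=\begin{bmatrix}U_1(z)&W_2(z)\end{bmatrix}D,\qquad \Psi(z)=D^{-1}\begin{bmatrix}W_1(z)\\ U_2(z)\end{bmatrix},$$ where $U_1\in L^\infty_{n\times l}$, $U_2\in L^\infty_{(n-l)\times n}$, $W_1\in H^\infty_{l\times n}$, $W_2\in H^\infty_{n\times(n-l)}$. In this case $H_\Phi T_\Psi=H_{U_1W_1}$.
   Context: $\mathbb{T}$ is the unit circle. For $E=\mathbb{C}^n$, $L^2_E$ is the space of $E$-valued square-integrable functions on $\mathbb T$, $H^2_E$ the $E$-valued Hardy space, $L^\infty_{B(E)}$ the algebra of essentially bounded $n\times n$ matrix-valued functions on $\mathbb{T}$. $L^\infty_{m\times l}$ and $H^\infty_{m\times l}$ denote the $m\times l$ matrix-valued functions on $\mathbb T$ with entries in $L^\infty$ and $H^\infty$ respectively. $P$ is the orthogonal projection of $L^2_E$ onto $H^2_E$, $Q=I-P$, and $(Jf)(w)=\overline{w}f(\overline{w})$ on $L^2_E$. For $\Phi\in L^\infty_{B(E)}$ the block Toeplitz operator on $H^2_E$ is $T_\Phi h=P[\Phi h]$ and the block Hankel operator on $H^2_E$ is $H_\Phi h=JQ[\Phi h]$. A bounded operator $X$ on $H^2_E$ is a block Hankel operator if it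 equals $H_F$ for some symbol $F$; these operators are characterized by the equation $XS_E=S_E^*X$, where $S_E$ is the shift (multiplication by the independent variable) on $H^2_E$. *)

(* Defs.v *)
From HB Require Import structures.
From mathcomp Require Import all_boot all_order all_algebra.
From mathcomp Require Import complex.
From mathcomp Require Import all_classical all_reals all_analysis.

Set Implicit Arguments.
Unset Strict Implicit.
Unset Printing Implicit Defensive.
Import Order.TTheory GRing.Theory Num.Theory.

Local Open Scope classical_set_scope.
Local Open Scope complex_scope.
Local Open Scope ring_scope.

Record circle (R : realType) := Circle {
  circle_val :> R[i] ;
  circle_valP : `|circle_val| == 1 }.

HB.instance Definition _ (R : realType) := [isSub for @circle_val R].
HB.instance Definition _ (R : realType) := [Choice of circle R by <:].

Lemma normc_cis (R : realType) (t : R) : `|(cos t +i* sin t : R[i])| == 1.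
Proof. by rewrite normc_def /= cos2Dsin2 sqrtr1. Qed.

Definition cis (R : realType) (t : R) : circle R := Circle (normc_cis t).

Lemma normc_conj (R : realType) (z : circle R) : `|conjc (z : R[i])| == 1.
Proof.
by case: z => -[a b] zP; move: (zP); rewrite /= !normc_def /= sqrrN.
Qed.

Definition circle_conj (R : realType) (z : circle R) : circle R :=
  Circle (normc_conj z).

Section circle_measure.
Variable R : realType.

HB.instance Definition _ := isPointed.Build (circle R) (cis 0).

(* Final sigma-algebra of t |-> e^{it}.  As this map is a 2pi-periodic Borel
   isomorphism from `]-pi, pi] onto the circle, it is the Borel one. *)
Definition circle_measurable : set (set (circle R)) :=
  image_set_system setT (@cis R) measurable.

Let circle_sigma_algebra : sigma_algebra setT circle_measurable.
Proof. exact/sigma_algebra_image/sigma_algebra_measurable. Qed.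

Let circle_measurable0 : circle_measurable set0.
Proof. by case: circle_sigma_algebra. Qed.

Let circle_measurableC A : circle_measurable A -> circle_measurable (~` A).
Proof. by case: circle_sigma_algebra => _ + _ => /[apply]; rewrite setTD. Qed.

Let circle_measurable_bigcup (F : (set (circle R))^nat) :
  (forall i, circle_measurable (F i)) -> circle_measurable (\bigcup_i F i).
Proof. by case: circle_sigma_algebra => _ _; apply. Qed.

HB.instance Definition _ := isMeasurable.Build default_measure_display
  (circle R) circle_measurable0 circle_measurableC circle_measurable_bigcup.

Lemma measurable_cis : measurable_fun setT (@cis R).
Proof. by move=> _ A. Qed.

Definition mpipi : measurable (`]- pi, pi] : set R) := measurable_itv _.

Lemma inv2pi_ge0 : 0 <= (pi *+ 2)^-1 :> R.
Proof. by rewrite invr_ge0 mulrn_wge0 // pi_ge0. Qed.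

Let angle_measure :=
  mscale (NngNum inv2pi_ge0) (mrestr lebesgue_measure mpipi).

Definition arc_measure : set (circle R) -> \bar R :=
  pushforward angle_measure (@cis R).

HB.instance Definition _ := Measure.copy arc_measure
  (measure_function_pushforward__canonical__measure_function_Measure
     angle_measure measurable_cis).

Let arc_measureT : arc_measure setT = 1%E.
Proof.
rewrite /arc_measure /pushforward /angle_measure /mscale /=.
rewrite preimage_setT /mrestr setTI lebesgue_measure_itv /= lte_fin gtrN ?pi_gt0 //.
by rewrite -EFinD opprK -mulr2n -EFinM mulVf // mulrn_eq0 /= gt_eqF // pi_gt0.
Qed.

HB.instance Definition _ :=
  Measure_isProbability.Build _ _ _ arc_measure arc_measureT.

End circle_measure.

Section hardy.
Variable R : realType.
Implicit Types (p : \bar R) (n m l : nat).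

Definition Cintegral (f : circle R -> R[i]) : R[i] :=
  (\int[@arc_measure R]_z complex.Re (f z))%R +i*
  (\int[@arc_measure R]_z complex.Im (f z))%R.

Definition Lp p (f : circle R -> R[i]) : Prop :=
  (fun z => complex.Re (f z)) \in Lfun (@arc_measure R) p /\
  (fun z => complex.Im (f z)) \in Lfun (@arc_measure R) p.

Definition fourier (f : circle R -> R[i]) (k : int) : R[i] :=
  Cintegral (fun z => f z * (z : R[i]) ^ (- k)).

(* H^p consists of the boundary functions, i.e. of the L^p functions without
   Fourier coefficients of negative index. *)
Definition Hp p (f : circle R -> R[i]) : Prop :=
  Lp p f /\ forall k : int, k < 0 -> fourier f k = 0.

Definition Lp_mx p m l (F : circle R -> 'M[R[i]]_(m, l)) : Prop :=
  forall i j, Lp p (fun z => F z i j).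

Definition Hp_mx p m l (F : circle R -> 'M[R[i]]_(m, l)) : Prop :=
  forall i j, Hp p (fun z => F z i j).

End hardy.

(* Elements of L^p spaces are represented by functions; equality of elements is
   equality almost everywhere. *)
Notation "f =ae g" := (f = g %[ae @arc_measure _])
  (at level 70, no associativity).

Notation Linf F := (Lp_mx +oo%E F).
Notation Hinf F := (Hp_mx +oo%E F).
Notation L2 f := (Lp_mx 2%:E f).
Notation H2 f := (Hp_mx 2%:E f).

Section operators.
Variables (R : realType) (n : nat).
Local Notation vfun := (circle R -> 'cV[R[i]]_n).
Local Notation mfun := (circle R -> 'M[R[i]]_n).
Implicit Types (f g h : vfun) (Phi Psi F : mfun) (X Y : vfun -> vfun).

Definition inner f g : R[i] :=
  Cintegral (fun z => \sum_(i < n) f z i 0 * conjc (g z i 0)).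

Definition is_H2_proj f g : Prop :=
  H2 g /\ forall h, H2 h -> inner (f - g) h = 0.

(* The orthogonal projection of L2 onto H2: the projection of f is unique up to
   almost everywhere equality, and xget chooses a representative. *)
Definition projP f : vfun := xget (cst 0) [set g | is_H2_proj f g].

Definition projQ f : vfun := f - projP f.

Definition flipJ f : vfun :=
  fun w => conjc (w : R[i]) *: f (circle_conj w).

Definition mulop F f : vfun := fun z => F z *m f z.

Definition toeplitz F h : vfun := projP (mulop F h).

Definition hankel F h : vfun := flipJ (projQ (mulop F h)).

Definition eq_on_H2 X Y : Prop := forall h, H2 h -> X h =ae Y h.

Definition is_block_hankel X : Prop :=
  exists2 F : mfun, Linf F & eq_on_H2 X (hankel F).

End operators.

Definition splits (R : realType) (n : nat) (Phi Psi : circle R -> 'M[R[i]]_n)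
    (D : 'M[R[i]]_n) (l : nat) (le_ln : (l <= n)%N)
    (U1 : circle R -> 'M[R[i]]_(n, l))
    (U2 : circle R -> 'M[R[i]]_(n - l, n))
    (W1 : circle R -> 'M[R[i]]_(l, n))
    (W2 : circle R -> 'M[R[i]]_(n, n - l)) : Prop :=
  [/\ D \in unitmx,
      [/\ Linf U1, Linf U2, Hinf W1 & Hinf W2],
      Phi =ae (fun z =>
        castmx (erefl n, subnKC le_ln) (row_mx (U1 z) (W2 z)) *m D) &
      Psi =ae (fun z =>
        invmx D *m castmx (subnKC le_ln, erefl n) (col_mx (W1 z) (U2 z)))].

(* Main.v *)
Require Import Defs.
From mathcomp Require Import all_boot all_order all_algebra.
From mathcomp Require Import complex.
From mathcomp Require Import all_classical all_reals all_analysis.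
From mathcomp Require Import measurable_realfun ess_sup_inf ring lra.

Set Implicit Arguments.
Unset Strict Implicit.
Unset Printing Implicit Defensive.
Import Order.TTheory GRing.Theory Num.Theory.
Import numFieldNormedType.Exports.
Local Open Scope classical_set_scope.
Local Open Scope complex_scope.
Local Open Scope ring_scope.

(** Write F^(k) for the matrix of the k-th Fourier coefficients of F. Both sides
    of the equivalence say that

      Phi^(-j) Psi^(-k) = 0  for all j, k >= 1.                            [*]

    If H_Phi T_Psi = H_F, apply this to h = z^m v and to z h. The negative
    coefficients of F (z h) are those of F h shifted by one place, so those of
    Phi P(Psi h) and Phi P(Psi z h) must be shifts of each other too. But
    P(z Psi h) = z P(Psi h) + c, where the constant c = Psi^(-m-1) v is what z
    moves from the co-analytic part of Psi h into H^2. Hence Phi c has no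
    negative coefficient, which is [*] ([block_hankel_fourier]).

    Given [*], let K be the space of row vectors u with u Psi^(-k) = 0 for all
    k >= 1; the rows of every Phi^(-j) lie in K. Complete a basis of K to the
    rows of an invertible D ([adapted_basis]): the first l = dim K rows of
    D Psi are analytic, and so are the last n - l columns of Phi D^-1, and
    these blocks are the required splitting ([splits_of_fourier]).

    Conversely, for a splitting, D P(Psi h) = (W1 h, P(U2 h)) because P commutes
    with constant matrices and fixes W1 h. Hence
    Phi P(Psi h) = U1 W1 h + W2 P(U2 h), whose last term lies in H^2 and is
    invisible to a Hankel operator ([hankel_toeplitz_split], [splits_hankel]).

    Three facts of harmonic analysis make this rigorous. The projection P exists
    and acts on Fourier coefficients by truncation: by Bessel's inequality the
    analytic partial sums of a Fourier series form a Cauchy sequence, and L^2 is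
    complete ([L2_complete], [riesz_projection], [projP_fourier]). A function
    of L^2 whose Fourier coefficients all vanish is null, since indicators of
    arcs are bounded limits of trigonometric polynomials ([fourier_eq0_ae]).
    Finally H^oo H^2 is contained in H^2, because the first two facts make
    analytic polynomials dense in H^2 ([Hinf_mulH2]). *)

(** * Real functions in L^2 and in L^oo *)

Section real_L2.
Context d (T : measurableType d) (R : realType).
Variable mu : {measure set T -> \bar R}.

Lemma Lfun2P (f : T -> R) : f \in Lfun mu 2%:E <->
  measurable_fun setT f /\ (\int[mu]_x (f x ^+ 2)%:E < +oo)%E.
Proof.
have E : (\int[mu]_x (f x ^+ 2)%:E = \int[mu]_x (`|f x|%:E `^ 2))%E.
  by apply: eq_integral => x _ /=; rewrite powR_mulrn// real_normK// num_real.
split=> [fL|[mf intf]].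
  have mf : measurable_fun setT f by move: fL => /andP[/[!inE]].
  split=> //; have /integrableP[_] := Lfun2_integrable_sqr fL.
  apply: le_lt_trans; apply: ge0_le_integral => //=.
  - by move=> x _; rewrite lee_fin sqr_ge0.
  - by apply/measurable_EFinP; exact: measurable_funX.
  - by apply/measurable_EFinP; apply: measurableT_comp => //; exact: measurable_funX.
  - by move=> x _; rewrite lee_fin ler_norm.
rewrite inE; apply/andP; split; rewrite inE//=.
rewrite /finite_norm unlock poweR_lty//.
by move: intf; rewrite E.
Qed.

Lemma Lfun_measurable (p : \bar R) (f : T -> R) : f \in Lfun mu p ->
  measurable_fun setT f.
Proof. by move=> /andP[/[!inE]]. Qed.

Lemma LfunD (p : \bar R) (p1 : (1 <= p)%E) (f g : T -> R) :
  f \in Lfun mu p -> g \in Lfun mu p -> (fun x => f x + g x) \in Lfun mu p.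
Proof. by move=> fL gL; apply: (Lfun_addr_closed mu p1).2. Qed.

Lemma LfunN (p : \bar R) (f : T -> R) :
  f \in Lfun mu p -> (fun x => - f x) \in Lfun mu p.
Proof. by move=> /(@Lfun_oppr_closed _ _ _ mu p). Qed.

Hypothesis mu0 : (0 < mu setT)%E.

Lemma Lfunoo_bounded (f : T -> R) : f \in Lfun mu +oo%E ->
  exists M, \forall x \ae mu, `|f x| <= M.
Proof.
move=> /andP[_ /[!inE]/=]; rewrite /finite_norm unlock /= mu0.
exact: ess_supr_bounded.
Qed.

Lemma ae_bounded_Lfunoo (f : T -> R) (M : R) :
  measurable_fun setT f -> (\forall x \ae mu, `|f x| <= M) ->
  f \in Lfun mu +oo%E.
Proof.
move=> mf fM; apply/andP; split; rewrite inE//= /finite_norm unlock mu0.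
rewrite (@le_lt_trans _ _ M%:E)// ?ltry//.
by apply/ess_supP; apply: filterS fM => x /=; rewrite lee_fin.
Qed.

Lemma Lfunoo_mulLfun2 (f g : T -> R) :
  f \in Lfun mu +oo%E -> g \in Lfun mu 2%:E ->
  (fun x => f x * g x) \in Lfun mu 2%:E.
Proof.
move=> fL /Lfun2P[mg intg]; have mf := Lfun_measurable fL.
have [M fM] := Lfunoo_bounded fL.
apply/Lfun2P; split; first exact: measurable_funM.
apply: (@le_lt_trans _ _ (\int[mu]_x ((M ^+ 2)%:E * (g x ^+ 2)%:E)%E)%E).
  apply: ae_ge0_le_integral => //.
  - by move=> x _; rewrite lee_fin sqr_ge0.
  - by apply/measurable_EFinP; apply: measurable_funX; exact: measurable_funM.
  - by move=> x _; rewrite -EFinM lee_fin mulr_ge0// sqr_ge0.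
  - apply: emeasurable_funM => //; apply/measurable_EFinP.
    exact: measurable_funX.
  - apply: filterS fM => x fM _; rewrite -EFinM lee_fin exprMn.
    rewrite ler_wpM2r ?sqr_ge0// -real_normK ?num_real//.
    by rewrite ler_sqr ?nnegrE// (le_trans _ fM).
rewrite ge0_integralZl//.
- by rewrite lte_mul_pinfty// lee_fin sqr_ge0.
- by apply/measurable_EFinP; exact: measurable_funX.
- by move=> x _; rewrite lee_fin sqr_ge0.
- by rewrite lee_fin sqr_ge0.
Qed.

Lemma LfunooM (f g : T -> R) :
  f \in Lfun mu +oo%E -> g \in Lfun mu +oo%E ->
  (fun x => f x * g x) \in Lfun mu +oo%E.
Proof.
move=> fL gL; have mf := Lfun_measurable fL; have mg := Lfun_measurable gL.
have [M fM] := Lfunoo_bounded fL; have [N gN] := Lfunoo_bounded gL.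
apply: (@ae_bounded_Lfunoo _ (M * N)); first exact: measurable_funM.
by apply: filterS2 fM gN => x fM gN; rewrite normrM ler_pM.
Qed.

End real_L2.

(** * Completeness of real L^2 *)

Section real_L2_completeness.
Context d (T : measurableType d) (R : realType) (P : probability T R).

(** Integrate the inequality |x| <= (x^2 / t + t) / 2 with t = 2^-j against a
    probability measure. *)
Lemma integral_abs_le_sqr (f : T -> R) j : measurable_fun setT f ->
  (\int[P]_x (f x ^+ 2)%:E <= (4^-1 ^+ j)%:E)%E ->
  (\int[P]_x `|f x|%:E <= (2^-1 ^+ j)%:E)%E.
Proof.
move=> mf; set t : R := 2^-1 ^+ j => fj.
have t0 : 0 < t by rewrite exprn_gt0// invr_gt0.
have mf2 : measurable_fun setT (fun x => (f x ^+ 2)%:E).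
  by apply/measurable_EFinP; exact: measurable_funX.
apply: (@le_trans _ _ (\int[P]_x ((t^-1 / 2)%:E * (f x ^+ 2)%:E + (t / 2)%:E)%E)%E).
  apply: ge0_le_integral => //=.
  - by apply/measurable_EFinP; exact: measurableT_comp.
  - by apply: emeasurable_funD => //; exact: measurable_funeM.
  - move=> x _; rewrite -EFinM -EFinD lee_fin -subr_ge0.
    have -> : t^-1 / 2 * f x ^+ 2 + t / 2 - `|f x| = t^-1 / 2 * (`|f x| - t) ^+ 2.
      rewrite -(real_normK (num_real (f x))); field; exact: lt0r_neq0.
    by rewrite mulr_ge0 ?sqr_ge0// divr_ge0// invr_ge0 ltW.
rewrite ge0_integralD//=; last 3 first.
- by move=> x _; rewrite -EFinM lee_fin mulr_ge0 ?sqr_ge0// divr_ge0// invr_ge0 ltW.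
- exact: measurable_funeM.
- by move=> x _; rewrite lee_fin divr_ge0// ltW.
rewrite ge0_integralZl//; last 2 first.
- by move=> x _; rewrite lee_fin sqr_ge0.
- by rewrite lee_fin divr_ge0// invr_ge0 ltW.
rewrite integral_cst// [X in (_ + _ * X)%E](_ : _ = 1%E) ?mule1; last exact: probability_setT.
have {fj} : (\int[P]_x (f x ^+ 2)%:E <= (t ^+ 2)%:E)%E.
  have E : 4^-1 = 2^-1 ^+ 2 :> R by rewrite exprVn -natrX.
  by apply: le_trans fj _; rewrite lee_fin /t E -!exprM mulnC.
move=> /(@lee_pmul _ (t^-1 / 2)%:E (t^-1 / 2)%:E) h.
rewrite (le_trans (leeD (h _ _ _) (le_refl _)))//.
- by rewrite lee_fin divr_ge0// invr_ge0 ltW.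
- by apply: integral_ge0 => x _; rewrite lee_fin sqr_ge0.
- rewrite -EFinM -EFinD lee_fin.
  have -> : t^-1 / 2 * t ^+ 2 + t / 2 = t by field; exact: lt0r_neq0.
  by [].
Qed.

(** The increments have a summable L^1 norm by [integral_abs_le_sqr], so the
    series of their absolute values is integrable and thus finite almost
    everywhere. *)
Lemma L2_cauchy_subseq_ae_cvg (v : (T -> R)^nat) :
  (forall j, v j \in Lfun P 2%:E) ->
  (forall j, (\int[P]_x ((v j.+1 x - v j x) ^+ 2)%:E <= (4^-1 ^+ j)%:E)%E) ->
  \forall x \ae P, cvgn (fun j => v j x).
Proof.
move=> vL vC.
have mv j : measurable_fun setT (v j) := Lfun_measurable (vL j).
pose G x := (\sum_(0 <= j <oo) `|v j.+1 x - v j x|%:E)%E.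
have mt j : measurable_fun setT (fun x => `|v j.+1 x - v j x|%:E).
  by apply/measurable_EFinP; apply: measurableT_comp => //; exact: measurable_funB.
have mG : measurable_fun setT G.
  by apply: ge0_emeasurable_sum => // k x _ _; rewrite lee_fin.
have intG : (\int[P]_x G x < +oo)%E.
  rewrite /G integral_nneseries //.
  apply: (@le_lt_trans _ _ (\sum_(0 <= j <oo) (2 / (2 ^ (j + 1))%:R : R)%:E)%E).
    apply: lee_nneseries => [j _ _|j _]; first by apply: integral_ge0 => x _; rewrite lee_fin.
    have -> : 2 / (2 ^ (j + 1))%:R = 2^-1 ^+ j :> R.
      by rewrite addn1 expnS natrM natrX invfM mulrA divff ?mul1r ?exprVn// pnatr_eq0.
    by apply: integral_abs_le_sqr => //; exact: measurable_funB.
  by rewrite (cvg_lim _ (@cvg_geometric_eseries_half R 2 0))// ltry.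
have /(integrable_ae measurableT) : P.-integrable setT G.
  apply/integrableP; split=> //.
  under eq_integral do rewrite gee0_abs ?nneseries_ge0//.
  by [].
apply: filterS => x /(_ I) Gfin.
have -> : (fun j => v j x) = (fun j => v 0%N x + series (telescope (fun j => v j x)) j).
  by apply/funext => j; exact: (eq_sum_telescope (fun j => v j x)).
apply: is_cvgD; first exact: is_cvg_cst.
apply: normed_cvg.
have E n : [normed series (telescope (fun j => v j x))] n =
    \sum_(0 <= j < n) `|v j.+1 x - v j x| by [].
apply: nondecreasing_is_cvgn.
  apply/nondecreasing_seqP => n; rewrite !E big_nat_recr//= lerDl//.
exists (fine (G x)) => _ [n _ <-]; rewrite E -lee_fin fineK// -sumEFin.
apply: nneseries_lim_ge => k _ _; by rewrite lee_fin.
Qed.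

(** Riesz-Fischer: a subsequence with geometrically small increments converges
    almost everywhere, and Fatou's lemma shows that its pointwise limit is also
    the limit in mean of the whole sequence. *)
Lemma L2_complete (u : (T -> R)^nat) :
  (forall n, u n \in Lfun P 2%:E) ->
  (forall e, 0 < e -> exists N, forall m n, (N <= m)%N -> (N <= n)%N ->
    (\int[P]_x ((u m x - u n x) ^+ 2)%:E <= e%:E)%E) ->
  exists2 v, v \in Lfun P 2%:E & forall e, 0 < e -> exists N,
    forall n, (N <= n)%N -> (\int[P]_x ((v x - u n x) ^+ 2)%:E <= e%:E)%E.
Proof.
move=> uL uC.
have um n : measurable_fun setT (u n) := Lfun_measurable (uL n).
have /choice[N NP] : forall j, exists N, forall m n, (N <= m)%N -> (N <= n)%N ->
    (\int[P]_x ((u m x - u n x) ^+ 2)%:E <= (4^-1 ^+ j)%:E)%E.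
  by move=> j; apply: uC; rewrite exprn_gt0.
(* A sum of the ranks N i dominates each of them, and increases with j. *)
pose M j := (\sum_(i < j.+1) N i)%N.
have NM i j : (i <= j)%N -> (N i <= M j)%N.
  move=> ij; rewrite /M (bigD1 (Ordinal (ij : (i < j.+1)%N)))//=.
  exact: leq_addr.
pose v j := u (M j).
have mv j : measurable_fun setT (v j) by exact: um.
have cvg_v : \forall x \ae P, cvgn (fun j => v j x).
  apply: L2_cauchy_subseq_ae_cvg => j; first exact: uL.
  by apply: NP; apply: NM.
(* The upper limit is measurable, and it is the limit wherever there is one. *)
pose w x := fine (limn_esup (fun j => (v j x)%:E)).
have mw : measurable_fun setT w.
  apply: measurableT_comp => //.
  by apply: measurable_fun_limn_esup => n; apply/measurable_EFinP.
have main i n : (N i <= n)%N -> (\int[P]_x ((w x - u n x) ^+ 2)%:E <= (4^-1 ^+ i)%:E)%E.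
  move=> Nin.
  pose f j x := ((v j x - u n x) ^+ 2)%:E.
  have mf j : measurable_fun setT (f j).
    by apply/measurable_EFinP; apply: measurable_funX; exact: measurable_funB.
  have f0 j x : (0 <= f j x)%E by rewrite lee_fin sqr_ge0.
  have -> : (\int[P]_x ((w x - u n x) ^+ 2)%:E = \int[P]_x limn_einf (f^~ x))%E.
    apply: ge0_ae_eq_integral => //.
    - by apply/measurable_EFinP; apply: measurable_funX; exact: measurable_funB.
    - under eq_fun => x do rewrite -[limn_einf _]oppeK -limn_esupN.
      apply: measurableT_comp => //; apply: measurable_fun_limn_esup => j.
      exact: measurableT_comp.
    - by move=> x _; rewrite lee_fin sqr_ge0.
    - move=> x _; rewrite limn_einf_lim; apply: lime_ge; first exact: is_cvg_einfs.
      by apply: nearW => k; apply: le_ereal_inf_tmp => _ [j _ <-].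
    - apply: filterS cvg_v => x cx _.
      have /cvg_limn_einf_sup[_ ws] : (v j x)%:E @[j --> \oo] --> (limn (fun j => v j x))%:E.
        by apply: cvg_EFin => //; exact: nearW.
      have wE : w x = limn (fun j => v j x) by rewrite /w ws.
      apply/esym; apply: (cvg_limn_einf_sup _).1.
      apply: cvg_EFin; first exact: nearW.
      rewrite wE.
      have cB : v j x - u n x @[j --> \oo] --> limn (fun j => v j x) - u n x.
        by apply: cvgB => //; exact: cvg_cst.
      exact: (cvgM cB cB).
  apply: le_trans (fatou _ measurableT mf _) _ => //.
  rewrite limn_einf_lim; apply: lime_le; first exact: is_cvg_einfs.
  near=> k; apply: (@le_trans _ _ (\int[P]_x f (k + i)%N x)%E).
    apply: ereal_inf_lbound; exists (k + i)%N => //=. exact: leq_addr.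
  apply: NP => //; apply: NM. exact: leq_addl.
exists w.
  have -> : w = (fun x => (w x - u (N 0%N) x) + u (N 0%N) x) by apply/funext => x; rewrite subrK.
  apply: LfunD => //; first by rewrite lee1n.
  apply/Lfun2P; split; first exact: measurable_funB.
  by apply: le_lt_trans (main 0%N (N 0%N) _) _; rewrite ?ltry.
move=> e e0.
have [i ie] : exists i, 4^-1 ^+ i <= e.
  have := @cvg_expr R 4^-1; rewrite ger0_norm ?invr_ge0// invf_lt1// ltr1n => /(_ isT).
  move=> /cvgrPdist_le/(_ _ e0)[i _ /(_ i (leqnn i))] /=.
  rewrite sub0r normrN ger0_norm; last by rewrite exprn_ge0.
  by exists i.
exists (N i) => n Nin; apply: le_trans (main _ _ Nin) _.
by rewrite lee_fin.
Unshelve. all: end_near.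
Qed.
End real_L2_completeness.

(** * The arc-length measure *)

Section circle_facts.
Variable R : realType.
Local Notation mu := (@arc_measure R).
Local Notation leb := (@lebesgue_measure R).
Local Notation I := ([set` `]- pi, pi]] : set R)%R.

(** The sigma-algebra of the circle is the final one for [cis]. *)
Lemma measurable_circleP d (U : measurableType d) (f : circle R -> U) :
  measurable_fun setT f <-> measurable_fun setT (f \o @cis R).
Proof.
split=> mf; first exact: measurableT_comp mf (@measurable_cis R).
move=> _ B mB; rewrite setTI.
have := mf measurableT B mB; rewrite !setTI => mB'.
by rewrite /measurable/= /circle_measurable /image_set_system/= setTI.
Qed.

Lemma ge0_arc_integral (f : circle R -> \bar R) : measurable_fun setT f ->
  (forall z, 0 <= f z)%E ->
  (\int[mu]_z f z =
   ((pi *+ 2)^-1)%:E * \int[leb]_(t in I) f (cis t))%E.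
Proof.
move=> mf f0.
rewrite ge0_integral_pushforward//.
have mfc : measurable_fun setT (f \o @cis R) by apply/measurable_circleP.
rewrite preimage_setT ge0_integral_mscale//; last first.
  by move=> x _; exact: f0.
congr (_ * _)%E.
have -> := @ge0_negligible_integral _ _ _ (mrestr leb (@mpipi R)) setT (~` I)
  (f \o @cis R) (measurableC (@mpipi R)) measurableT mfc (fun x _ => f0 (cis x)); last first.
  by rewrite /= /mrestr setICl measure0.
rewrite setTD setCK; apply: eq_measure_integral => A mA AD.
by rewrite /= /mrestr setIidl.
Qed.

Lemma cis_conj (t : R) : circle_conj (cis t) = cis (- t).
Proof. by apply: val_inj; rewrite /= cosN sinN. Qed.

Lemma measurable_circle_conj : measurable_fun setT (@circle_conj R).
Proof.
apply/measurable_circleP.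
have -> : @circle_conj R \o @cis R = @cis R \o -%R.
  by apply/funext => t; exact: cis_conj.
by apply: measurableT_comp; [exact: measurable_cis|exact: oppr_measurable].
Qed.

(** On angles, conjugation is t |-> -t, which preserves Lebesgue measure; it maps
    ]-pi, pi] to itself up to the end point pi. *)
Lemma ae_circle_conj (Q : circle R -> Prop) :
  (\forall z \ae mu, Q z) -> \forall z \ae mu, Q (circle_conj z).
Proof.
move=> [N [mN N0 subN]]; exists (@circle_conj R @^-1` N); split.
- by rewrite -[X in measurable X]setTI; exact: measurable_circle_conj.
- move: N0; rewrite /arc_measure /pushforward/= /mscale/= /mrestr/=.
  have mC : measurable (@cis R @^-1` N).
    by rewrite -[X in measurable X]setTI; exact: measurable_cis.
  rewrite -comp_preimage (_ : _ \o _ = @cis R \o -%R); last first.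
    by apply/funext => t; exact: cis_conj.
  rewrite comp_preimage; move: (_ @^-1` N) mC => C mC.
  move=> /eqP; rewrite mule_eq0 eqe invr_eq0 mulrn_eq0/= gt_eqF ?pi_gt0//= => /eqP CI0.
  rewrite (_ : leb _ = 0%E) ?mule0//.
  have mCI : measurable (C `&` I) by exact: measurableI.
  apply: (@measure_negligible _ _ _ leb).
    apply: measurableI => //.
    by rewrite -[X in measurable X]setTI; exact: oppr_measurable.
  apply: (@negligibleS _ _ _ leb ((-%R @^-1` (C `&` I)) `|` [set pi])).
    move=> t [Ct]; rewrite /= in_itv/= => /andP[pt tp].
    have [->|npi] := eqVneq t pi; first by right.
    by left; split=> //=; rewrite in_itv/= ltrN2 lerNl (ltW pt) lt_neqAle npi tp.
  apply: negligibleU; apply/(@negligibleP _ _ _ leb) => //.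
  + by rewrite -[X in measurable X]setTI; exact: oppr_measurable.
  + by rewrite -[RHS]CI0 -(lebesgue_measureN mCI).
  + exact: lebesgue_measure_set1.
- by move=> z /= nQ; apply: subN.
Qed.

Lemma cisX (t : R) (k : int) :
  (cis t : R[i]) ^ k = cos (k%:~R * t) +i* sin (k%:~R * t).
Proof.
have nat_case (n : nat) : (cis t : R[i]) ^+ n = cos (n%:R * t) +i* sin (n%:R * t).
  elim: n => [|n IH]; first by rewrite expr0 mul0r cos0 sin0.
  rewrite exprS IH mulrS mulrDl mul1r cosD sinD /=.
  by apply/eqP; rewrite eq_complex/= eqxx/= addrC.
case: k => n; first by rewrite -exprnP nat_case.
rewrite NegzE -exprnN nat_case mulNr cosN sinN.
have -> : (cos (n.+1%:R * t) +i* - sin (n.+1%:R * t) : R[i]) =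
    (cos (n.+1%:R * t) +i* sin (n.+1%:R * t))^*%C by [].
rewrite -nat_case; set x : R[i] := _ ^+ _.
have x1 : `|x| = 1 by rewrite /x normrX (eqP (circle_valP (cis t))) expr1n.
by rewrite invc_norm x1 expr1n invr1 mul1r.
Qed.

Lemma integral_cisX (k : int) : k != 0 ->
  (\int[leb]_(t in I) (cos (k%:~R * t))%:E = 0)%E /\
  (\int[leb]_(t in I) (sin (k%:~R * t))%:E = 0)%E.
Proof.
move=> k0; have kR0 : k%:~R != 0 :> R by rewrite intr_eq0.
have pp : - pi < pi :> R by rewrite gtrN ?pi_gt0.
have dlin (x : R) : is_derive x 1 (fun t : R => k%:~R * t) k%:~R.
  have := @is_deriveZ _ _ _ id k%:~R x 1 _ (is_derive_id _ _).
  by rewrite /GRing.scale/= mulr1.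
have cmul (x : R) : {for x, continuous (fun t : R => k%:~R * t)}.
  by apply: cvgMl_tmp; exact: cvg_id.
have FTC (F f : R -> R) : continuous f -> (forall x : R, is_derive x 1 F (f x)) ->
    F (- pi) = F pi -> (\int[leb]_(t in I) (f t)%:E = 0)%E.
  move=> cf dF Fpi.
  have cF : continuous F.
    by move=> x; apply/differentiable_continuous/derivable1_diffP; exact: ex_derive.
  rewrite integral_itv_obnd_cbnd; last first.
    by apply/measurable_EFinP; apply: measurable_funTS; exact: continuous_measurable_fun.
  rewrite (@continuous_FTC2 _ f F)//.
  + by rewrite Fpi -EFinD subrr.
  + exact: continuous_subspaceT.
  + split.
    * by move=> x _; exact: ex_derive.
    * by apply: cvg_at_right_filter; exact: cF.
    * by apply: cvg_at_left_filter; exact: cF.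
  + by move=> x _; rewrite derive1E; exact: derive_val.
have sinZ : sin (k%:~R * pi) = 0 :> R.
  have nat_case (n : nat) : sin (n%:R * pi) = 0 :> R.
    elim: n => [|n IH]; first by rewrite mul0r sin0.
    by rewrite mulrS mulrDl mul1r addrC sinDpi IH oppr0.
  by case: (k) => n; rewrite ?NegzE ?mulrNz ?mulNr ?sinN nat_case ?oppr0.
split.
- apply: (FTC (fun t => k%:~R^-1 * sin (k%:~R * t))).
  + move=> x; apply: (@continuous_comp _ _ _ (fun t : R => k%:~R * t) cos).
      exact: cmul.
    exact: continuous_cos.
  + move=> x.
    apply: is_derive_eq (@is_deriveZ _ _ _ _ k%:~R^-1 x 1 _ (is_derive1_comp (is_derive_sin _) (dlin x))) _.
    by rewrite /GRing.scale/=; field.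
  + by rewrite mulrN sinN sinZ oppr0.
- apply: (FTC (fun t => - k%:~R^-1 * cos (k%:~R * t))).
  + move=> x; apply: (@continuous_comp _ _ _ (fun t : R => k%:~R * t) sin).
      exact: cmul.
    exact: continuous_sin.
  + move=> x.
    apply: is_derive_eq (@is_deriveZ _ _ _ _ (- k%:~R^-1) x 1 _ (is_derive1_comp (is_derive_cos _) (dlin x))) _.
    by rewrite /GRing.scale/=; field.
  + by rewrite mulrN cosN.
Qed.

End circle_facts.

(** * Complex functions in L^p of the circle *)

Section complex_parts.
Variable R : rcfType.
Implicit Types x y : R[i].
Local Notation Re := complex.Re.
Local Notation Im := complex.Im.

Lemma ReD x y : Re (x + y) = Re x + Re y. Proof. by case: x y => ? ? []. Qed.
Lemma ImD x y : Im (x + y) = Im x + Im y. Proof. by case: x y => ? ? []. Qed.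
Lemma ReN x : Re (- x) = - Re x. Proof. by case: x. Qed.
Lemma ImN x : Im (- x) = - Im x. Proof. by case: x. Qed.
Lemma ReM x y : Re (x * y) = Re x * Re y - Im x * Im y.
Proof. by case: x y => ? ? []. Qed.
Lemma ImM x y : Im (x * y) = Re x * Im y + Im x * Re y.
Proof. by case: x y => ? ? []. Qed.
Lemma ReJ x : Re (conjc x) = Re x. Proof. by case: x. Qed.
Lemma ImJ x : Im (conjc x) = - Im x. Proof. by case: x. Qed.
Lemma complex_ext x y : Re x = Re y -> Im x = Im y -> x = y.
Proof. by case: x y => ? ? [? ?] /= -> ->. Qed.
End complex_parts.

Section complex_Lp.
Variable R : realType.
Local Notation mu := (@arc_measure R).
Local Notation Re := complex.Re.
Local Notation Im := complex.Im.
Implicit Types (f g : circle R -> R[i]) (p : \bar R).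

Lemma arc_measureT : mu setT = 1%E.
Proof. exact: (@probability_setT _ _ _ mu). Qed.

Lemma arc_measure_gt0 : (0 < mu setT)%E. Proof. by rewrite arc_measureT. Qed.

Lemma le1_2 : (1 <= 2%:E :> \bar R)%E. Proof. by rewrite lee1n. Qed.

Lemma le1_oo : (1 <= +oo :> \bar R)%E. Proof. by rewrite leey. Qed.

Section closure.
Variable (p : \bar R).
Hypothesis p1 : (1 <= p)%E.

Lemma LfunZ (u : circle R -> R) (a : R) : u \in Lfun mu p ->
  (fun z => a * u z) \in Lfun mu p.
Proof.
move=> uL; have [L0 LZ] := Lfun_submod_closed mu p1.
have -> : (fun z => a * u z) = a *: u + 0 by apply/funext => z; rewrite addr0.
exact: LZ.
Qed.

Lemma LpD f g : Lp p f -> Lp p g -> Lp p (fun z => f z + g z).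
Proof.
move=> [f1 f2] [g1 g2]; split.
- by under eq_fun do rewrite ReD; exact: LfunD.
- by under eq_fun do rewrite ImD; exact: LfunD.
Qed.

Lemma LpN f : Lp p f -> Lp p (fun z => - f z).
Proof.
move=> [f1 f2]; split.
- by under eq_fun do rewrite ReN; exact: LfunN.
- by under eq_fun do rewrite ImN; exact: LfunN.
Qed.

Lemma LpB f g : Lp p f -> Lp p g -> Lp p (fun z => f z - g z).
Proof. by move=> fL gL; apply: LpD => //; exact: LpN. Qed.

Lemma LpJ f : Lp p f -> Lp p (fun z => conjc (f z)).
Proof.
move=> [f1 f2]; split.
- by under eq_fun do rewrite ReJ.
- by under eq_fun do rewrite ImJ; exact: LfunN.
Qed.

Lemma LpZ f c : Lp p f -> Lp p (fun z => c * f z).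
Proof.
move=> [f1 f2]; split.
- under eq_fun do rewrite ReM.
  by apply: LfunD => //; [|apply: LfunN]; exact: LfunZ.
- by under eq_fun do rewrite ImM; apply: LfunD => //; exact: LfunZ.
Qed.

End closure.

Lemma Linf_bounded f M : measurable_fun setT (fun z => Re (f z)) ->
  measurable_fun setT (fun z => Im (f z)) ->
  (forall z, `|Re (f z)| <= M /\ `|Im (f z)| <= M) -> Lp +oo%E f.
Proof.
move=> mRe mIm fM; split; apply: (@ae_bounded_Lfunoo _ _ _ _ arc_measure_gt0 _ M) => //;
  by apply: aeW => z; case: (fM z).
Qed.

Lemma Lp_cst p c : (1 <= p)%E -> Lp p (cst c : circle R -> R[i]).
Proof.
move=> p1; have : Lp +oo%E (cst c : circle R -> R[i]).
  apply: (@Linf_bounded _ (Num.max `|Re c| `|Im c|)) => // z.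
  by rewrite !le_max !lexx orbT.
have mu_fin : mu setT \is a fin_num by rewrite arc_measureT.
by move=> [c1 c2]; split; apply: (Lfun_subset p1 le1_oo mu_fin _) => //; exact: leey.
Qed.

Lemma Linf_Lp p f : (1 <= p)%E -> Lp +oo%E f -> Lp p f.
Proof.
have mu_fin : mu setT \is a fin_num by rewrite arc_measureT.
by move=> p1 [c1 c2]; split; apply: (Lfun_subset p1 le1_oo mu_fin _) => //; exact: leey.
Qed.

Lemma Linf_L2 f : Lp +oo%E f -> Lp 2%:E f.
Proof. by apply: Linf_Lp; exact: le1_2. Qed.

Lemma L2_L1 f : Lp 2%:E f -> Lp 1%:E f.
Proof.
have mu_fin : mu setT \is a fin_num by rewrite arc_measureT.
by move=> [f1 f2]; split; apply: (Lfun_subset12 mu_fin).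
Qed.

Lemma Linf_mulL2 f g : Lp +oo%E f -> Lp 2%:E g -> Lp 2%:E (fun z => f z * g z).
Proof.
have mu0 := arc_measure_gt0; have l12 := le1_2.
move=> [f1 f2] [g1 g2]; split.
- under eq_fun do rewrite ReM.
  by apply: LfunD => //; [|apply: LfunN]; exact: Lfunoo_mulLfun2.
- by under eq_fun do rewrite ImM; apply: LfunD => //; exact: Lfunoo_mulLfun2.
Qed.

Lemma LinfM f g : Lp +oo%E f -> Lp +oo%E g -> Lp +oo%E (fun z => f z * g z).
Proof.
have mu0 := arc_measure_gt0; have l12 := le1_oo.
move=> [f1 f2] [g1 g2]; split.
- under eq_fun do rewrite ReM.
  by apply: LfunD => //; [|apply: LfunN]; exact: LfunooM.
- by under eq_fun do rewrite ImM; apply: LfunD => //; exact: LfunooM.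
Qed.

Lemma L2_mul_L1 f g : Lp 2%:E f -> Lp 2%:E g -> Lp 1%:E (fun z => f z * g z).
Proof.
move=> [f1 f2] [g1 g2]; split.
- under eq_fun do rewrite ReM.
  by apply: LfunD => //; [|apply: LfunN]; exact: Lfun2_mul_Lfun1.
- by under eq_fun do rewrite ImM; apply: LfunD => //; exact: Lfun2_mul_Lfun1.
Qed.

Lemma Lp_sum p (I : Type) (s : seq I) (F : I -> circle R -> R[i]) : (1 <= p)%E ->
  (forall i, Lp p (F i)) -> Lp p (fun z => \sum_(i <- s) F i z).
Proof.
move=> p1 FL; elim: s => [|i s IH].
  by under eq_fun do rewrite big_nil; exact: Lp_cst.
by under eq_fun do rewrite big_cons; exact: LpD.
Qed.

Lemma measurable_circle_Re : measurable_fun setT (fun z : circle R => Re z).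
Proof.
apply/measurable_circleP; apply: continuous_measurable_fun.
exact: continuous_cos.
Qed.

Lemma measurable_circle_Im : measurable_fun setT (fun z : circle R => Im z).
Proof.
apply/measurable_circleP; apply: continuous_measurable_fun.
exact: continuous_sin.
Qed.

Lemma circle_normE (z : circle R) : Re z ^+ 2 + Im z ^+ 2 = 1.
Proof.
have /eqP := circle_valP z; move=> /(congr1 (fun x => x ^+ 2)).
by rewrite -add_Re2_Im2 expr1n => /(congr1 (@complex.Re _)).
Qed.

Lemma Linf_id : Lp +oo%E (fun z : circle R => z : R[i]).
Proof.
apply: (@Linf_bounded _ 1); first exact: measurable_circle_Re.
  exact: measurable_circle_Im.
move=> z; have E := circle_normE z.
rewrite -!(@ler_sqr _ _ 1) ?nnegrE// !real_normK ?num_real// expr1n -E.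
by rewrite lerDl lerDr !sqr_ge0.
Qed.

Lemma circle_conjE (z : circle R) : conjc (z : R[i]) = (z : R[i])^-1.
Proof. by rewrite invc_norm (eqP (circle_valP z)) expr1n invr1 mul1r. Qed.

Lemma circle_neq0 (z : circle R) : (z : R[i]) != 0.
Proof. by rewrite -normr_gt0 (eqP (circle_valP z)). Qed.

Lemma Linf_circleX (k : int) : Lp +oo%E (fun z : circle R => (z : R[i]) ^ k).
Proof.
have X (n : nat) : Lp +oo%E (fun z : circle R => (z : R[i]) ^+ n).
  elim: n => [|n IH]; first by under eq_fun do rewrite expr0; apply: Lp_cst; exact: le1_oo.
  under eq_fun do rewrite exprS.
  by apply: LinfM => //; exact: Linf_id.
case: k => n; first exact: X.
suff -> : (fun z : circle R => (z : R[i]) ^ Negz n) =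
    (fun z : circle R => conjc ((z : R[i]) ^+ n.+1)) by apply: LpJ; exact: X.
by apply/funext => z; rewrite rmorphXn/= circle_conjE NegzE -exprnN exprVn.
Qed.

End complex_Lp.

(** * Integrals of complex functions *)

Section complex_integral.
Variable R : realType.
Local Notation mu := (@arc_measure R).
Local Notation leb := (@lebesgue_measure R).
Local Notation I := ([set` `]- pi, pi]] : set R)%R.
Local Notation Re := complex.Re.
Local Notation Im := complex.Im.
Implicit Types (f g h : circle R -> R[i]) (p : \bar R).

Lemma L1_integrable f : Lp 1%:E f ->
  mu.-integrable setT (EFin \o (fun z => Re (f z))) /\
  mu.-integrable setT (EFin \o (fun z => Im (f z))).
Proof. by move=> [/Lfun1_integrable ? /Lfun1_integrable ?]. Qed.

Lemma CintegralD f g : Lp 1%:E f -> Lp 1%:E g ->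
  Cintegral (fun z => f z + g z) = Cintegral f + Cintegral g.
Proof.
move=> /L1_integrable[f1 f2] /L1_integrable[g1 g2].
apply: complex_ext; rewrite ?ReD ?ImD /=.
- by under eq_Rintegral do rewrite ReD; rewrite RintegralD.
- by under eq_Rintegral do rewrite ImD; rewrite RintegralD.
Qed.

Lemma CintegralZ f c : Lp 1%:E f ->
  Cintegral (fun z => c * f z) = c * Cintegral f.
Proof.
move=> /L1_integrable[f1 f2].
have iZ (r : R) (u : circle R -> R) : mu.-integrable setT (EFin \o u) ->
    mu.-integrable setT (EFin \o (fun z => r * u z)).
  by move=> iu; apply: (@integrableZl _ _ _ _ _ measurableT r _ iu).
apply: complex_ext; rewrite ?ReM ?ImM /=.
- by under eq_Rintegral do rewrite ReM; rewrite RintegralB ?RintegralZl//; exact: iZ.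
- by under eq_Rintegral do rewrite ImM; rewrite RintegralD ?RintegralZl//; exact: iZ.
Qed.

Lemma CintegralJ f : Lp 1%:E f ->
  Cintegral (fun z => conjc (f z)) = conjc (Cintegral f).
Proof.
move=> /L1_integrable[f1 f2]; apply: complex_ext => /=.
- by under eq_Rintegral do rewrite ReJ.
- under eq_Rintegral do rewrite ImJ -mulN1r.
  by rewrite RintegralZl// mulN1r.
Qed.

Lemma ae_eq_Rintegral (u v : circle R -> R) :
  measurable_fun setT u -> measurable_fun setT v -> u =ae v ->
  \int[mu]_z u z = \int[mu]_z v z.
Proof.
move=> um mv uv; congr fine; apply: ae_eq_integral => //.
- exact/measurable_EFinP.
- exact/measurable_EFinP.
- by apply: filterS uv => z uv /uv ->.
Qed.

Lemma ae_eq_Cintegral f g : Lp 1%:E f -> Lp 1%:E g -> f =ae g ->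
  Cintegral f = Cintegral g.
Proof.
move=> [/Lfun_measurable f1 /Lfun_measurable f2].
move=> [/Lfun_measurable g1 /Lfun_measurable g2] fg.
apply: complex_ext => /=; apply: ae_eq_Rintegral => //;
  by apply: filterS fg => z fg /fg ->.
Qed.

Lemma Cintegral0 : Cintegral (fun=> 0 : R[i]) = 0 :> R[i].
Proof. by apply: complex_ext => /=; rewrite Rintegral_cst ?mul0r. Qed.

Lemma Cintegral_sum (J : Type) (s : seq J) (F : J -> circle R -> R[i]) :
  (forall i, Lp 1%:E (F i)) ->
  Cintegral (fun z => \sum_(i <- s) F i z) = \sum_(i <- s) Cintegral (F i).
Proof.
move=> FL; elim: s => [|i s IH].
  by under eq_fun do rewrite big_nil; rewrite big_nil Cintegral0.
under eq_fun do rewrite big_cons; rewrite big_cons CintegralD ?IH//.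
exact: Lp_sum.
Qed.

Lemma arc_integrable (v : circle R -> \bar R) : mu.-integrable setT v ->
  leb.-integrable I (fun t => v (cis t)).
Proof.
move=> /integrableP[mv intv]; apply/integrableP; split.
  by apply: measurable_funTS; exact: measurableT_comp mv (@measurable_cis R).
move: intv; rewrite ge0_arc_integral//; last exact: measurableT_comp.
set X := (\int[leb]_(t in I) _)%E => cX.
have [Xoo|Xoo] := eqVneq X +oo%E; last by rewrite ltey.
by move: cX; rewrite Xoo gt0_muley ?ltxx// lte_fin invr_gt0 pmulrn_lgt0 ?pi_gt0.
Qed.

Lemma arc_integral (v : circle R -> \bar R) : mu.-integrable setT v ->
  (\int[mu]_z v z = ((pi *+ 2)^-1)%:E * \int[leb]_(t in I) v (cis t))%E.
Proof.
move=> iv; have mv := measurable_int mu iv.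
have iI := arc_integrable iv.
rewrite integralE (ge0_arc_integral (measurable_funepos mv))//.
rewrite (ge0_arc_integral (measurable_funeneg mv))//.
have E : (\int[leb]_(t in I) v (cis t) =
    \int[leb]_(t in I) v^\+ (cis t) - \int[leb]_(t in I) v^\- (cis t))%E.
  by have := integralE leb I (v \o @cis R); rewrite funepos_comp funeneg_comp.
have mI : @measurable _ (measurableTypeR R) I := @mpipi R.
have := integrable_add_def mI iI.
rewrite -[fun t => v (cis t)]/(v \o @cis R) funepos_comp funeneg_comp => AB.
by rewrite E; apply/esym/muleBr.
Qed.

Lemma Cintegral_circleX (k : int) :
  Cintegral (fun z : circle R => (z : R[i]) ^ k) = (k == 0)%:R.
Proof.
have [->|k0] := eqVneq k 0.
  have mu1 : fine (mu setT) = 1 by rewrite arc_measureT.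
  by apply: complex_ext => /=; rewrite Rintegral_cst// ?mul0r// mul1r; exact: mu1.
have [c s] := integral_cisX R k0.
have [iRe iIm] := L1_integrable (Linf_Lp (lexx _) (Linf_circleX R k)).
have zero (u : circle R -> R) : mu.-integrable setT (EFin \o u) ->
    (\int[leb]_(t in I) (u (cis t))%:E = 0)%E -> \int[mu]_z u z = 0.
  by move=> iu I0; rewrite /Rintegral (arc_integral iu) I0 mule0.
apply: complex_ext; apply: zero => //.
- by under eq_integral do rewrite cisX.
- by under eq_integral do rewrite cisX.
Qed.

End complex_integral.

(** * The Hermitian product of L^2 *)

Section hermitian_product.
Variable R : realType.
Local Notation mu := (@arc_measure R).
Local Notation Re := complex.Re.
Local Notation Im := complex.Im.
Local Notation L2 := (@Lp R 2%:E).
Implicit Types (f g h : circle R -> R[i]) (c : R[i]).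

Definition cdot f g : R[i] := Cintegral (fun z => f z * conjc (g z)).

Definition sqnorm f : R := \int[mu]_z (Re (f z) ^+ 2 + Im (f z) ^+ 2).

Lemma cdotDl f g h : L2 f -> L2 g -> L2 h ->
  cdot (fun z => f z + g z) h = cdot f h + cdot g h.
Proof.
move=> fL gL hL; rewrite /cdot; under eq_fun do rewrite mulrDl.
by rewrite CintegralD//; apply: L2_mul_L1 => //; exact: LpJ.
Qed.

Lemma cdotZl f h c : L2 f -> L2 h ->
  cdot (fun z => c * f z) h = c * cdot f h.
Proof.
move=> fL hL; rewrite /cdot; under eq_fun do rewrite -mulrA.
by rewrite CintegralZ//; apply: L2_mul_L1 => //; exact: LpJ.
Qed.

Lemma cdotC f g : L2 f -> L2 g -> cdot g f = conjc (cdot f g).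
Proof.
move=> fL gL; rewrite /cdot -CintegralJ; last by apply: L2_mul_L1 => //; exact: LpJ.
by congr Cintegral; apply/funext => z; rewrite rmorphM/= conjcK mulrC.
Qed.

Lemma cdotDr f g h : L2 f -> L2 g -> L2 h ->
  cdot h (fun z => f z + g z) = cdot h f + cdot h g.
Proof.
move=> fL gL hL; rewrite cdotC ?cdotDl ?rmorphD//; last exact: (LpD (le1_2 R)).
by rewrite [cdot h f]cdotC// [cdot h g]cdotC.
Qed.

Lemma cdotZr f h c : L2 f -> L2 h ->
  cdot h (fun z => c * f z) = conjc c * cdot h f.
Proof.
move=> fL hL; rewrite cdotC ?cdotZl ?rmorphM//; last exact: (LpZ (le1_2 R)).
by rewrite [cdot h f]cdotC.
Qed.

Lemma sqnorm_ge0 f : 0 <= sqnorm f.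
Proof. by apply: Rintegral_ge0 => z _; rewrite addr_ge0 ?sqr_ge0. Qed.

Lemma sqnormE f : (sqnorm f)%:C = cdot f f.
Proof.
have E z : f z * conjc (f z) = (Re (f z) ^+ 2 + Im (f z) ^+ 2)%:C.
  by rewrite add_Re2_Im2 -sqr_normc.
apply: complex_ext => /=; first by apply: eq_Rintegral => z _; rewrite E.
by under eq_Rintegral do rewrite E/=; rewrite Rintegral_cst// mul0r.
Qed.

Lemma sqnorm_addZ g h c : L2 g -> L2 h ->
  sqnorm (fun z => g z + c * h z) =
  sqnorm g + Re (conjc c * cdot g h) *+ 2 + Re (c * conjc c) * sqnorm h.
Proof.
move=> gL hL; have cL := LpZ (le1_2 R) c hL; have gcL := LpD (le1_2 R) gL cL.
have -> : sqnorm (fun z => g z + c * h z) = Re (sqnorm (fun z => g z + c * h z))%:C by [].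
rewrite sqnormE cdotDl// !cdotDr// !cdotZl// !cdotZr// -!sqnormE.
rewrite (cdotC gL hL); case: c {cL gcL} => a b; case: (cdot g h) => x y /=.
ring.
Qed.

(** A form of continuity of the product in its first argument that avoids
    limits. It follows from the nonnegativity of the square norm of g - t c h for
    small g: this number is at most |g|^2 - t |c|^2 as soon as t |h|^2 <= 1. *)
Lemma cdot_small_eq0 h c : L2 h ->
  (forall e, 0 < e -> exists2 g, L2 g & sqnorm g <= e /\ cdot g h = c) -> c = 0.
Proof.
move=> hL small; pose t := (sqnorm h + 1)^-1.
have t0 : 0 < t by rewrite invr_gt0 ltr_wpDl ?sqnorm_ge0.
have tH : t * sqnorm h <= 1.
  by rewrite mulrC ler_pdivrMr ?mul1r ?lerDl// ltr_wpDl ?sqnorm_ge0.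
pose q := Re c ^+ 2 + Im c ^+ 2.
have q0 : 0 <= q by rewrite addr_ge0 ?sqr_ge0.
have qe e : 0 < e -> t * q <= e.
  move=> /small[g gL [ge gh]].
  have := sqnorm_ge0 (fun z => g z + (- t%:C * c) * h z).
  rewrite sqnorm_addZ// gh.
  have -> : Re (conjc (- t%:C * c) * c) = - t * q.
    by rewrite /q; case: (c) => a b /=; ring.
  have -> : Re (- t%:C * c * conjc (- t%:C * c)) = t ^+ 2 * q.
    by rewrite /q; case: (c) => a b /=; ring.
  have : t ^+ 2 * q * sqnorm h <= t * q.
    have -> : t ^+ 2 * q * sqnorm h = t * q * (t * sqnorm h) by ring.
    by rewrite ler_piMr// mulr_ge0// ltW.
  lra.
have : t * q <= 0.
  by apply/ler_addgt0Pr => e e0; rewrite add0r qe.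
rewrite pmulr_rle0// => qle0.
have /eqP : q = 0 by apply/eqP; rewrite eq_le qle0 q0.
rewrite paddr_eq0 ?sqr_ge0// !sqrf_eq0 => /andP[/eqP rc /eqP ic].
exact: complex_ext.
Qed.

End hermitian_product.

(** * Fourier coefficients *)

Section fourier_coefficients.
Variable R : realType.
Local Notation mu := (@arc_measure R).
Local Notation Re := complex.Re.
Local Notation Im := complex.Im.
Local Notation L2 := (@Lp R 2%:E).
Implicit Types (f g h : circle R -> R[i]) (c : R[i]) (k : int).

Definition monomial k : circle R -> R[i] := fun z => (z : R[i]) ^ k.

Lemma Linf_monomial k : Lp +oo%E (monomial k).
Proof. exact: Linf_circleX. Qed.

Lemma L2_monomial k : L2 (monomial k).
Proof. exact/Linf_L2/Linf_monomial. Qed.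

Lemma monomialD k l z : monomial (k + l) z = monomial k z * monomial l z.
Proof. by rewrite /monomial expfzDr// circle_neq0. Qed.

Lemma monomialJ k z : conjc (monomial k z) = monomial (- k) z.
Proof. by rewrite /monomial rmorphXz/= ?unitfE ?circle_neq0// circle_conjE exprz_inv. Qed.

Lemma fourierE f k : fourier f k = cdot f (monomial k).
Proof. by congr Cintegral; apply/funext => z; rewrite monomialJ. Qed.

Lemma L1_fourier f k : L2 f -> Lp 1%:E (fun z => f z * (z : R[i]) ^ (- k)).
Proof. by move=> fL; apply: L2_mul_L1 => //; exact: L2_monomial. Qed.

Lemma fourierD f g k : L2 f -> L2 g ->
  fourier (fun z => f z + g z) k = fourier f k + fourier g k.
Proof. by move=> fL gL; rewrite !fourierE cdotDl//; exact: L2_monomial. Qed.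

Lemma fourierZ f c k : L2 f -> fourier (fun z => c * f z) k = c * fourier f k.
Proof. by move=> fL; rewrite !fourierE cdotZl//; exact: L2_monomial. Qed.

Lemma fourierB f g k : L2 f -> L2 g ->
  fourier (fun z => f z - g z) k = fourier f k - fourier g k.
Proof.
move=> fL gL; under eq_fun do rewrite -mulN1r.
by rewrite fourierD ?fourierZ ?mulN1r//; exact: (LpZ (le1_2 R)).
Qed.

Lemma fourier_sum (J : Type) (s : seq J) (F : J -> circle R -> R[i]) k :
  (forall i, L2 (F i)) ->
  fourier (fun z => \sum_(i <- s) F i z) k = \sum_(i <- s) fourier (F i) k.
Proof.
move=> FL; rewrite /fourier -Cintegral_sum => [|i]; last exact: L1_fourier.
by congr Cintegral; apply/funext => z; rewrite mulr_suml.
Qed.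

Lemma ae_eq_fourier f g k : L2 f -> L2 g -> f =ae g -> fourier f k = fourier g k.
Proof.
move=> fL gL fg; apply: ae_eq_Cintegral; [exact: L1_fourier|exact: L1_fourier|].
by apply: filterS fg => z /[apply] ->.
Qed.

Lemma fourier_monomialM f l k :
  fourier (fun z => monomial l z * f z) k = fourier f (k - l).
Proof.
congr Cintegral; apply/funext => z; rewrite mulrC mulrA -monomialD.
by rewrite mulrC opprB addrC.
Qed.

Lemma fourier_monomial l k : fourier (monomial l) k = (k == l)%:R.
Proof.
rewrite eq_sym -subr_eq0 -Cintegral_circleX.
congr Cintegral; apply/funext => z; rewrite -monomialD.
by rewrite /monomial.
Qed.

Lemma sqnorm_monomial k : sqnorm (monomial k) = 1.
Proof.
have := sqnormE (monomial k); rewrite -fourierE fourier_monomial eqxx.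
by move=> /(congr1 (@complex.Re R)).
Qed.

Lemma sqnormN f : sqnorm (fun z => - f z) = sqnorm f.
Proof. by apply: eq_Rintegral => z _; rewrite ReN ImN !sqrrN. Qed.

Lemma integrable_Re2 f : L2 f ->
  mu.-integrable setT (EFin \o (fun z => Re (f z) ^+ 2)) /\
  mu.-integrable setT (EFin \o (fun z => Im (f z) ^+ 2)).
Proof. by move=> [/Lfun2_integrable_sqr ? /Lfun2_integrable_sqr]. Qed.

Lemma sqnorm_integral f : L2 f -> ((sqnorm f)%:E =
  \int[mu]_z (Re (f z) ^+ 2)%:E + \int[mu]_z (Im (f z) ^+ 2)%:E)%E.
Proof.
move=> fL; have [iR iI] := integrable_Re2 fL.
rewrite /sqnorm RintegralD// EFinD /Rintegral.
by rewrite !fineK//; exact: integrable_fin_num.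
Qed.

Lemma complex_L2_complete (u : nat -> circle R -> R[i]) :
  (forall n, L2 (u n)) ->
  (forall e, 0 < e -> exists N, forall m n, (N <= m)%N -> (N <= n)%N ->
    sqnorm (fun z => u m z - u n z) <= e) ->
  exists2 v, L2 v & forall e, 0 < e -> exists N,
    forall n, (N <= n)%N -> sqnorm (fun z => v z - u n z) <= e.
Proof.
move=> uL uC.
have uB m n : L2 (fun z => u m z - u n z) by exact: (LpB (le1_2 R)).
have [||v1 v1L v1C] := @L2_complete _ _ _ mu (fun n z => Re (u n z)).
- by move=> n; case: (uL n).
- move=> e /uC[N NP]; exists N => m n Nm Nn.
  rewrite (le_trans _ (_ : (sqnorm (fun z => u m z - u n z))%:E <= e%:E)%E)//; last first.
    by rewrite lee_fin NP.
  rewrite sqnorm_integral//; under eq_integral do rewrite -ReN -ReD.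
  by rewrite leeDl// integral_ge0// => z _; rewrite lee_fin sqr_ge0.
have [||v2 v2L v2C] := @L2_complete _ _ _ mu (fun n z => Im (u n z)).
- by move=> n; case: (uL n).
- move=> e /uC[N NP]; exists N => m n Nm Nn.
  rewrite (le_trans _ (_ : (sqnorm (fun z => u m z - u n z))%:E <= e%:E)%E)//; last first.
    by rewrite lee_fin NP.
  rewrite sqnorm_integral//; under eq_integral do rewrite -ImN -ImD.
  by rewrite leeDr// integral_ge0// => z _; rewrite lee_fin sqr_ge0.
have vL : L2 (fun z => v1 z +i* v2 z) by split.
exists (fun z => v1 z +i* v2 z) => // e e0.
have e20 : 0 < e / 2 by rewrite divr_gt0.
have [N1 N1P] := v1C _ e20; have [N2 N2P] := v2C _ e20.
exists (maxn N1 N2) => n; rewrite geq_max => /andP[/N1P n1 /N2P n2].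
rewrite -lee_fin sqnorm_integral; last exact: (LpB (le1_2 R)).
rewrite [e]splitr EFinD.
under eq_integral do rewrite ReD ReN/=.
under [X in (_ + X)%E]eq_integral do rewrite ImD ImN/=.
exact: leeD.
Qed.

(** Only the nonnegative frequencies are summed: the limit will be the projection
    on H^2, not f. *)
Definition partial_sum f N : circle R -> R[i] :=
  fun z => \sum_(i < N) fourier f i%:Z * monomial i%:Z z.

Lemma partial_sumS f N :
  partial_sum f N.+1 = (fun z => partial_sum f N z + fourier f N%:Z * monomial N%:Z z).
Proof. by apply/funext => z; rewrite /partial_sum big_ord_recr. Qed.

Lemma L2_partial_sum f N : L2 (partial_sum f N).
Proof.
apply: (Lp_sum _ (le1_2 R)) => i; apply: (LpZ (le1_2 R)).
exact: L2_monomial.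
Qed.

Lemma fourier_partial_sum f N k :
  fourier (partial_sum f N) k = \sum_(i < N) fourier f i%:Z * (k == i%:Z)%:R.
Proof.
rewrite fourier_sum => [|i]; last by apply: (LpZ (le1_2 R)); exact: L2_monomial.
apply: eq_bigr => i _; rewrite fourierZ ?fourier_monomial//.
exact: L2_monomial.
Qed.

Lemma fourier_partial_sum_lt f N (j : nat) : (j < N)%N ->
  fourier (partial_sum f N) j%:Z = fourier f j%:Z.
Proof.
move=> jN; rewrite fourier_partial_sum (bigD1 (Ordinal jN))//= eqxx mulr1 big1 ?addr0//.
by move=> i; rewrite -val_eqE eq_sym eqz_nat => /negPf ->; rewrite mulr0.
Qed.

Lemma fourier_partial_sum_ge f N (j : nat) : (N <= j)%N -> fourier (partial_sum f N) j%:Z = 0.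
Proof.
move=> Nj; rewrite fourier_partial_sum big1// => i _; rewrite eqz_nat gtn_eqF ?mulr0//.
exact: leq_trans (ltn_ord i) Nj.
Qed.

Lemma fourier_partial_sum_lt0 f N k : k < 0 -> fourier (partial_sum f N) k = 0.
Proof.
move=> k0; rewrite fourier_partial_sum big1// => i _.
by rewrite lt_eqF ?mulr0//; exact: lt_le_trans k0 _.
Qed.

Let sqc c := Re (c * conjc c).

Let sqc_ge0 c : 0 <= sqc c.
Proof. by case: c => a b; rewrite /sqc/= mulrN opprK addr_ge0// -expr2 sqr_ge0. Qed.

(** Pythagoras, one frequency at a time; the next lemma likewise. *)
Lemma sqnorm_partial_sumB f N d :
  sqnorm (fun z => partial_sum f (N + d) z - partial_sum f N z) =
  \sum_(N <= i < N + d) sqc (fourier f i%:Z).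
Proof.
elim: d => [|d IH].
  rewrite addn0 big_geq//; under eq_fun do rewrite subrr.
  by rewrite /sqnorm/= expr0n/= addr0 Rintegral_cst// mul0r.
rewrite addnS partial_sumS big_nat_recr ?leq_addr//= -IH.
have gL : L2 (fun z => partial_sum f (N + d) z - partial_sum f N z).
  by apply: (LpB (le1_2 R)); exact: L2_partial_sum.
under eq_fun do rewrite addrAC.
rewrite sqnorm_addZ//; last exact: L2_monomial.
rewrite -fourierE fourierB; try exact: L2_partial_sum.
rewrite !fourier_partial_sum_ge ?leq_addr// subr0 mulr0 mul0rn addr0.
by rewrite sqnorm_monomial mulr1.
Qed.

Lemma bessel f N : L2 f ->
  sqnorm (fun z => f z - partial_sum f N z) =
  sqnorm f - \sum_(0 <= i < N) sqc (fourier f i%:Z).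
Proof.
move=> fL; elim: N => [|N IH].
  rewrite big_geq// subr0; congr sqnorm; apply/funext => z.
  by rewrite /partial_sum big_ord0 subr0.
rewrite partial_sumS big_nat_recr//= opprD addrA -IH.
have gL : L2 (fun z => f z - partial_sum f N z).
  by apply: (LpB (le1_2 R)) => //; exact: L2_partial_sum.
under eq_fun do rewrite opprD addrA -mulNr.
rewrite sqnorm_addZ//; last exact: L2_monomial.
rewrite -fourierE fourierB//; last exact: L2_partial_sum.
rewrite fourier_partial_sum_ge// subr0 sqnorm_monomial mulr1 -addrA; congr (_ + _).
by rewrite /sqc; case: (fourier f _) => a b /=; ring.
Qed.

(** By [bessel] the sums of the squared moduli of the coefficients are bounded,
    hence convergent, and [sqnorm_partial_sumB] expresses the distance between
    two partial sums as a difference of two such sums. *)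
Lemma partial_sum_cauchy f : L2 f ->
  forall e, 0 < e -> exists N, forall m n, (N <= m)%N -> (N <= n)%N ->
    sqnorm (fun z => partial_sum f m z - partial_sum f n z) <= e.
Proof.
move=> fL e e0.
pose b n := \sum_(0 <= i < n) sqc (fourier f i%:Z).
have bS n d : b (n + d)%N = b n + \sum_(n <= i < n + d) sqc (fourier f i%:Z).
  by rewrite /b (big_cat_nat (leq0n n) (leq_addr d n)).
have b_le n : b n <= sqnorm f by rewrite -subr_ge0 -bessel// sqnorm_ge0.
have cb : cvgn b.
  apply: nondecreasing_is_cvgn.
    apply/nondecreasing_seqP => n; rewrite -addn1 bS lerDl.
    by apply: sumr_ge0 => i _; exact: sqc_ge0.
  by exists (sqnorm f) => _ [n _ <-].
have /cvgrPdist_le/(_ _ (divr_gt0 e0 (ltr0n _ 2)))[N _ NP] := cb.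
exists N.
have main m n : (N <= m)%N -> (m <= n)%N -> sqnorm (fun z => partial_sum f n z - partial_sum f m z) <= e.
  move=> Nm mn; rewrite -(subnKC mn) sqnorm_partial_sumB.
  have -> : \sum_(m <= i < m + (n - m)) sqc (fourier f i%:Z) = b n - b m.
    by rewrite -{2}(subnKC mn) bS addrAC subrr add0r.
  have /= := NP n (leq_trans Nm mn); have /= := NP m Nm.
  rewrite !ler_norml => /andP[h1 h2] /andP[h3 h4]; lra.
move=> m n Nm Nn; have [mn|/ltnW nm] := leqP m n; last exact: main.
by rewrite -sqnormN; under eq_fun do rewrite opprB; exact: main.
Qed.

(** Fourier coefficients pass to limits in L^2. *)
Lemma fourier_approx f k c :
  (forall e, 0 < e -> exists2 g, L2 g &
     sqnorm (fun z => f z - g z) <= e /\ fourier g k = c) ->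
  L2 f -> fourier f k = c.
Proof.
move=> H fL; apply/eqP; rewrite -subr_eq0; apply/eqP.
apply: (@cdot_small_eq0 _ (monomial k)); first exact: L2_monomial.
move=> e /H[g gL [ge gc]]; exists (fun z => f z - g z); first exact: (LpB (le1_2 R)).
by split=> //; rewrite -fourierE fourierB// gc.
Qed.

Lemma riesz_projection f : L2 f -> exists g, [/\ L2 g,
  forall k, 0 <= k -> fourier g k = fourier f k,
  forall k, k < 0 -> fourier g k = 0 &
  forall e, 0 < e -> exists N, sqnorm (fun z => g z - partial_sum f N z) <= e].
Proof.
move=> fL; have [g gL gC] := complex_L2_complete (L2_partial_sum f) (partial_sum_cauchy fL).
exists g; split=> //.
- case=> // j _; apply: fourier_approx => // e /gC[N NP].
  exists (partial_sum f (maxn N j.+1)); first exact: L2_partial_sum.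
  by split; [apply: NP; exact: leq_maxl|rewrite fourier_partial_sum_lt ?leq_maxr].
- move=> k k0; apply: fourier_approx => // e /gC[N NP].
  by exists (partial_sum f N); [exact: L2_partial_sum|split; [exact: NP|rewrite fourier_partial_sum_lt0]].
- by move=> e /gC[N NP]; exists N; exact: NP.
Qed.

End fourier_coefficients.

(** * Trigonometric polynomials close to the indicator of an arc *)

Section bernoulli_limit.
Variable R : realType.
Implicit Types (x y : R).

Lemma bernoulli_lower x n : 0 <= x <= 1 -> 1 - n%:R * x <= (1 - x) ^+ n.
Proof.
move=> /andP[x0 x1]; elim: n => [|n IH]; first by rewrite mul0r subr0 expr0.
rewrite exprS; apply: (@le_trans _ _ ((1 - x) * (1 - n%:R * x))); last first.
  by rewrite ler_wpM2l// subr_ge0.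
rewrite -subr_ge0 (_ : _ - _ = n%:R * x ^+ 2); first by rewrite mulr_ge0// sqr_ge0.
by rewrite mulrS; ring.
Qed.

Lemma bernoulli_upper x n : 0 <= x <= 1 -> (1 - x) ^+ n * (1 + n%:R * x) <= 1.
Proof.
move=> /andP[x0 x1]; elim: n => [|n IH]; first by rewrite mul0r addr0 mulr1 expr0.
apply: le_trans IH; rewrite exprSr -mulrA ler_wpM2l ?exprn_ge0 ?subr_ge0//.
rewrite -subr_ge0 (_ : _ - _ = (n.+1%:R) * x ^+ 2); first by rewrite mulr_ge0// sqr_ge0.
by rewrite mulrS; ring.
Qed.

(** Together with [threshold_cvg0]: (1 - y^n)^(2^n) tends to the indicator of
    y < 1/2 on [0, 1], except at 1/2. Bernoulli's inequality bounds it below by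
    1 - (2 y)^n and above by (2 y)^-n. *)
Lemma threshold_cvg1 y : 0 <= y < 2^-1 -> (1 - y ^+ n) ^+ (2 ^ n) @[n --> \oo] --> (1 : R).
Proof.
move=> /andP[y0 y12].
have y2 : 0 <= 2 * y < 1 by lra.
apply: (@squeeze_cvgr _ _ _ _ (fun n => 1 - (2 * y) ^+ n) (fun=> 1)).
- apply: nearW => n.
  have yn : 0 <= y ^+ n <= 1 by rewrite exprn_ge0// exprn_ile1//; lra.
  apply/andP; split; last by rewrite exprn_ile1//; lra.
  by apply: le_trans (bernoulli_lower (2 ^ n) yn); rewrite exprMn natrX.
- rewrite -[X in _ --> X]subr0; apply: cvgB; first exact: cvg_cst.
  by apply: cvg_expr; rewrite ger0_norm; lra.
- exact: cvg_cst.
Qed.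

Lemma threshold_cvg0 y : 2^-1 < y <= 1 -> (1 - y ^+ n) ^+ (2 ^ n) @[n --> \oo] --> (0 : R).
Proof.
move=> /andP[y12 y1].
have y0 : 0 < 2 * y by lra.
apply: (@squeeze_cvgr _ _ _ _ (fun=> 0) (fun n => ((2 * y)^-1) ^+ n)).
- apply: nearW => n.
  have yn : 0 <= y ^+ n <= 1 by rewrite exprn_ge0 ?exprn_ile1//; lra.
  apply/andP; split; first by rewrite exprn_ge0//; lra.
  rewrite exprVn -[leRHS]div1r ler_pdivlMr ?exprn_gt0//.
  apply: le_trans (bernoulli_upper (2 ^ n) yn).
  rewrite ler_wpM2l//; first by rewrite exprn_ge0//; lra.
  by rewrite exprMn natrX lerDr.
- exact: cvg_cst.
- apply: cvg_expr; rewrite ger0_norm ?invr_ge0; last lra.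
  by rewrite invf_lt1//; lra.
Qed.

End bernoulli_limit.

Section arcs.
Variable R : realType.
Implicit Types (t x : R).

(** For x and t in ]-pi, pi[, t != x, this value is smaller than 1/2 exactly when
    -pi < t < x: the midpoint of that arc is (x - pi) / 2 and its half-length is
    (x + pi) / 2. It is a trigonometric polynomial in t, scaled to take its values
    in [0, 1]. *)
Definition arc_threshold (x t : R) : R :=
  2^-1 + (cos ((x + pi) / 2) - cos (t - (x - pi) / 2)) / 4.

Lemma arc_threshold01 x t : 0 <= arc_threshold x t <= 1.
Proof.
have := cos_geN1 ((x + pi) / 2); have := cos_le1 ((x + pi) / 2).
have := cos_geN1 (t - (x - pi) / 2); have := cos_le1 (t - (x - pi) / 2).
by rewrite /arc_threshold; lra.
Qed.

Lemma arc_threshold_lt x t : - pi < x < pi -> - pi < t < x ->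
  arc_threshold x t < 2^-1.
Proof.
move=> /andP[px xp] /andP[pt tx].
have : cos ((x + pi) / 2) < cos (t - (x - pi) / 2).
  rewrite -(cos_norm (t - _)) ltr_cos ?in_itv/=; first by rewrite ltr_norml; lra.
  - by rewrite normr_ge0 /= ler_norml; lra.
  - by lra.
by rewrite /arc_threshold; lra.
Qed.

Lemma arc_threshold_gt x t : - pi < x < pi -> x < t < pi ->
  2^-1 < arc_threshold x t.
Proof.
move=> /andP[px xp] /andP[pt tx].
have : cos (t - (x - pi) / 2) < cos ((x + pi) / 2).
  have [h|h] := leP (t - (x - pi) / 2) pi.
    by rewrite ltr_cos ?in_itv/=; lra.
  rewrite -(cosN (t - _)) -(cosD2pi (- _)).
  by rewrite ltr_cos ?in_itv/= ?(mulr2n pi); lra.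
by rewrite /arc_threshold; lra.
Qed.

End arcs.

(** * A function is determined by its Fourier coefficients *)

Section fourier_uniqueness.
Variable R : realType.
Local Notation mu := (@arc_measure R).
Local Notation leb := (@lebesgue_measure R).
Local Notation I := ([set` `]- pi, pi]] : set R)%R.
Local Notation Re := complex.Re.
Local Notation Im := complex.Im.
Local Notation L2 := (@Lp R 2%:E).

(** Dominated convergence, with the factors of [threshold_cvg1] tending to the
    indicator of ]-pi, x] away from the two points x and pi. *)
Lemma integral_initial_arc_eq0 (F : R -> R) (x : R) :
  leb.-integrable I (EFin \o F) -> - pi < x < pi ->
  (forall n, \int[leb]_(t in I)
     (F t * (1 - arc_threshold x t ^+ n) ^+ (2 ^ n))%:E = 0)%E ->
  (\int[leb]_(t in `]- pi, x]) F t) = 0.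
Proof.
move=> iF xpi F0; have mI : @measurable _ (measurableTypeR R) I := @mpipi R.
have mF : measurable_fun I F by move/integrableP: iF => [/measurable_EFinP].
pose g n t := (1 - arc_threshold x t ^+ n) ^+ (2 ^ n).
have g01 n t : 0 <= g n t <= 1.
  have yn : 0 <= arc_threshold x t ^+ n <= 1.
    by have /andP[? ?] := arc_threshold01 x t; rewrite exprn_ge0//= exprn_ile1.
  by rewrite exprn_ge0 ?exprn_ile1//; lra.
have mg n : measurable_fun I (g n).
  apply: measurable_funTS; apply: measurable_funX; apply: measurable_funB => //.
  apply: measurable_funX; apply: measurable_funD => //.
  apply: measurable_funM => //; apply: measurable_funB => //.
  apply: continuous_measurable_fun => t; apply: continuous_comp; last exact: continuous_cos.
  by apply: cvgB; [exact: cvg_id|exact: cvg_cst].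
pose f_ n t := (F t * g n t)%:E.
pose f := (EFin \o F) \_ [set` `]-oo, x]].
have mf_ n : measurable_fun I (f_ n) by apply/measurable_EFinP; exact: measurable_funM.
have mf : measurable_fun I f.
  have mJ : @measurable _ (measurableTypeR R) [set` `]-oo, x]] by exact: measurable_itv.
  apply: (@measurable_restrict _ _ (measurableTypeR R) _ _ _ (EFin \o F) mJ mI).1.
  apply: (@measurable_funS _ _ (measurableTypeR R) _ I) => //.
  exact/measurable_EFinP.
have f_f : {ae leb, forall t, I t -> f_ ^~ t @ \oo --> f t}.
  have : leb.-negligible ([set x] `|` [set pi]).
    by apply: negligibleU; apply/negligibleP => //; exact: lebesgue_measure_set1.
  apply: negligibleS => t /=; apply: contra_notP => /not_orP[tx tpi].
  rewrite in_itv/= => /andP[pt tp].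
  have {tp tpi}tp : t < pi by rewrite lt_neqAle tp andbT; exact/eqP.
  have /andP[y0 y1] := arc_threshold01 x t.
  have [xt|tx'] := ltP x t.
  - have -> : f t = 0%E by rewrite /f patchE memNset//= in_itv/= leNgt xt.
    apply: (@cvg_EFin _ _ _ _ (f_^~ t) 0); first exact: nearW.
    rewrite -[X in _ --> X](mulr0 (F t)); apply: cvgMl_tmp.
    by apply: threshold_cvg0; rewrite y1 arc_threshold_gt// xt tp.
  - have -> : f t = (F t)%:E by rewrite /f patchE mem_set//= in_itv.
    apply: (@cvg_EFin _ _ _ _ (f_^~ t) (F t)); first exact: nearW.
    rewrite -[X in _ --> X](mulr1 (F t)); apply: cvgMl_tmp.
    apply: threshold_cvg1; rewrite y0 arc_threshold_lt// pt lt_neqAle tx' andbT.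
    exact/eqP.
have f_F : {ae leb, forall t n, I t -> (`|f_ n t| <= `|(F t)%:E|)%E}.
  apply: aeW => t n _; rewrite lee_fin normrM ler_piMr//.
  by have /andP[? ?] := g01 n t; rewrite ger0_norm.
have [_ _] := dominated_convergence mI mf_ mf f_f (integrable_abse iF) f_F.
rewrite (_ : [sequence _]_n = fun=> 0%E); last by apply/funext => n; exact: F0.
move=> /(cvg_unique _ (cvg_cst 0%E)) /esym f0; rewrite /Rintegral.
have <- : I `&` [set` `]-oo, x]] = [set` `]- pi, x]].
  apply/seteqP; split=> t /=; rewrite !in_itv/=; first by move=> [/andP[-> _] ->].
  by move=> /andP[-> tx]; rewrite tx (le_trans tx)//; lra.
by rewrite integral_mkcondr f0.
Qed.

(** The indefinite integral of F vanishes identically, and Lebesgue's theorem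
    says that its derivative is F almost everywhere. *)
Lemma ae_eq0_initial_integrals (F : R -> R) :
  leb.-integrable I (EFin \o F) ->
  (forall x, - pi < x < pi -> (\int[leb]_(t in `]- pi, x]) F t) = 0) ->
  {ae leb, forall t, I t -> F t = 0}.
Proof.
move=> iF F0; have mI : @measurable _ (measurableTypeR R) I := @mpipi R.
have lF := integrable_locally mI iF.
have := @FTC1 R (F \_ I) (BRight (- pi)) _ lF.
have iFT : leb.-integrable setT (EFin \o (F \_ I)).
  by rewrite -restrict_EFin; apply: (integrable_mkcond _ mI).1.
have iFy y : leb.-integrable [set` `]- pi, y]] (EFin \o (F \_ I)).
  by apply: integrableS iFT => //; exact: measurable_itv.
move=> /(_ iFy).
pose G x := \int[leb]_(t in `]- pi, x]) ((F \_ I) t).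
have G0 x : - pi < x < pi -> G x = 0.
  move=> xpi; rewrite -(F0 x xpi); apply: eq_Rintegral => t; rewrite inE/= in_itv/= => /andP[pt tx].
  by rewrite patchE mem_set//= in_itv/= pt (le_trans tx)//; lra.
move=> FTC.
have npi : leb.-negligible [set pi].
  by apply/negligibleP => //; exact: lebesgue_measure_set1.
have := negligibleU FTC npi; apply: negligibleS => t /=.
apply: contra_notP => /not_orP[/contrapT].
move=> FTCt tpi; rewrite in_itv/= => /andP[pt tp].
have {tp tpi}tp : t < pi by rewrite lt_neqAle tp andbT; exact/eqP.
have [_] := FTCt pt; rewrite derive1E -/G.
rewrite (@near_eq_derive _ _ _ G (cst 0)); last first.
  near=> x; rewrite G0//; apply/andP; split; near: x.
    exact: lt_nbhsr.
  exact: lt_nbhsl.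
by rewrite derive_cst patchE mem_set//= in_itv/= pt ltW.
Unshelve. all: end_near.
Qed.

Implicit Types (f g : circle R -> R[i]).

Lemma ae_circle_eq0 (u : circle R -> R) : measurable_fun setT u ->
  {ae leb, forall t, I t -> u (cis t) = 0} -> \forall z \ae mu, u z = 0.
Proof.
move=> um u0.
pose N : set (circle R) := [set z | u z != 0].
have mN : measurable N.
  have -> : N = u @^-1` (~` [set 0]).
    by apply/seteqP; split=> z /= /eqP.
  by rewrite -[X in measurable X]setTI; apply: um => //; exact: measurableC.
exists N; split=> //; last by move=> z /= /eqP.
suff -> : mu N = (((pi *+ 2)^-1)%:E * leb ((@cis R @^-1` N) `&` I))%E.
  rewrite (@measure_negligible _ _ _ leb) ?mule0//.
    apply: measurableI; last exact: mpipi.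
    by rewrite -[X in measurable X]setTI; exact: measurable_cis.
  apply: negligibleS u0 => t /= [ut It] /(_ It) u0.
  by move: ut; rewrite /N/= u0 eqxx.
by [].
Qed.

(** This class of multipliers is an algebra containing all z^k, hence all
    trigonometric polynomials; working with it avoids writing the latter as
    explicit linear combinations. *)
Definition zero_spectrum_stable (p : circle R -> R[i]) :=
  Lp +oo%E p /\ forall f, L2 f -> (forall k, fourier f k = 0) ->
  forall k, fourier (fun z => p z * f z) k = 0.

Lemma zero_spectrum_stable_cst c : zero_spectrum_stable (cst c).
Proof.
split; first exact/Lp_cst/le1_oo.
by move=> f fL f0 k; rewrite fourierZ// f0 mulr0.
Qed.

Lemma zero_spectrum_stable_monomial l : zero_spectrum_stable (monomial l).
Proof.
by split; [exact: Linf_monomial|move=> f fL f0 k; rewrite fourier_monomialM f0].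
Qed.

Lemma zero_spectrum_stableD p q : zero_spectrum_stable p -> zero_spectrum_stable q ->
  zero_spectrum_stable (fun z => p z + q z).
Proof.
move=> [pL p0] [qL q0]; split; first exact: (LpD (le1_oo R)).
move=> f fL f0 k; under eq_fun do rewrite mulrDl.
by rewrite fourierD ?p0 ?q0 ?addr0//; exact: Linf_mulL2.
Qed.

Lemma zero_spectrum_stableM p q : zero_spectrum_stable p -> zero_spectrum_stable q ->
  zero_spectrum_stable (fun z => p z * q z).
Proof.
move=> [pL p0] [qL q0]; split; first exact: LinfM.
move=> f fL f0 k; under eq_fun do rewrite -mulrA.
apply: p0; first exact: Linf_mulL2.
exact: q0.
Qed.

Lemma zero_spectrum_stableX p n : zero_spectrum_stable p -> zero_spectrum_stable (fun z => p z ^+ n).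
Proof.
move=> kp; elim: n => [|n IH].
  by under eq_fun do rewrite expr0; exact: zero_spectrum_stable_cst.
by under eq_fun do rewrite exprS; exact: zero_spectrum_stableM.
Qed.

(** By the addition formula, cos (t - m) is a combination of z and 1 / z on the
    circle. *)
Lemma zero_spectrum_stable_threshold (x : R) (n : nat) : exists2 p, zero_spectrum_stable p &
  forall t, p (cis t) = ((1 - arc_threshold x t ^+ n) ^+ (2 ^ n))%:C.
Proof.
pose m := (x - pi) / 2; pose d := (x + pi) / 2.
pose y z := (2^-1 + cos d / 4)%:C +
  ((- 8^-1)%:C * (cis (- m) : R[i]) * monomial 1 z +
   (- 8^-1)%:C * (cis m : R[i]) * monomial (-1) z).
have yE t : y (cis t) = (arc_threshold x t)%:C.
  rewrite /y /monomial !cisX mulrN1z mulr1z mulN1r mul1r.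
  by apply: complex_ext; rewrite /= ?cosN ?sinN /arc_threshold -/m -/d ?cosB; field.
exists (fun z => (1 + (- 1) * y z ^+ n) ^+ (2 ^ n)).
  apply: zero_spectrum_stableX; apply: zero_spectrum_stableD; first exact: zero_spectrum_stable_cst.
  apply: zero_spectrum_stableM; first exact: zero_spectrum_stable_cst.
  apply: zero_spectrum_stableX; apply: zero_spectrum_stableD; first exact: zero_spectrum_stable_cst.
  by apply: zero_spectrum_stableD; apply: zero_spectrum_stableM; [exact: zero_spectrum_stable_cst|exact: zero_spectrum_stable_monomial|
    exact: zero_spectrum_stable_cst|exact: zero_spectrum_stable_monomial].
move=> t; rewrite yE mulN1r -rmorphXn -(rmorph1 (real_complex R)) -rmorphB.
by rewrite -rmorphXn.
Qed.

(** If f has a zero spectrum then so does p f for every trigonometric polynomial p,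
    and the coefficient of index 0 says that p f has integral 0. Taking for p the
    real polynomials that approximate indicators of arcs, the integrals of the
    real and imaginary parts of f over all arcs ]-pi, x] vanish. *)
Lemma fourier_eq0_ae f : L2 f -> (forall k, fourier f k = 0) ->
  \forall z \ae mu, f z = 0.
Proof.
move=> fL f0; have [fRe fIm] := L1_integrable (L2_L1 fL).
have main (x : R) n :
    (\int[leb]_(t in I) (Re (f (cis t)) * (1 - arc_threshold x t ^+ n) ^+ (2 ^ n))%:E = 0)%E /\
    (\int[leb]_(t in I) (Im (f (cis t)) * (1 - arc_threshold x t ^+ n) ^+ (2 ^ n))%:E = 0)%E.
  have [p [pL p0] pE] := zero_spectrum_stable_threshold x n.
  have := p0 f fL f0 0; rewrite /fourier oppr0.
  have [iRe iIm] := L1_integrable (L2_L1 (Linf_mulL2 pL fL)).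
  under eq_fun do rewrite expr0z mulr1.
  have c0 : ((pi *+ 2)^-1 : R) != 0 by rewrite invr_eq0 mulrn_eq0/= gt_eqF ?pi_gt0.
  have zero (u : circle R -> R) : mu.-integrable setT (EFin \o u) ->
      \int[mu]_z u z = 0 -> (\int[leb]_(t in I) (u (cis t))%:E = 0)%E.
    move=> iu; have mI : @measurable _ (measurableTypeR R) I := @mpipi R.
    have ifin := integrable_fin_num mI (arc_integrable iu).
    rewrite /Rintegral (arc_integral iu) => /eqP.
    rewrite fineM//.
    rewrite mulf_eq0 (negPf c0)/= => /eqP h; by rewrite -[LHS]fineK ?h.
  move=> E; split.
  - have := zero _ iRe (congr1 (@complex.Re R) E).
    by under eq_integral do rewrite ReM pE/= mul0r subr0 mulrC.
  - have := zero _ iIm (congr1 (@complex.Im R) E).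
    by under eq_integral do rewrite ImM pE/= mul0r addr0 mulrC.
have [/Lfun_measurable mRe /Lfun_measurable mIm] := fL.
have Re0 : \forall z \ae mu, Re (f z) = 0.
  apply: ae_circle_eq0 => //.
  apply: (@ae_eq0_initial_integrals (fun t => Re (f (cis t)))).
    exact: (arc_integrable fRe).
  move=> x xpi; apply: integral_initial_arc_eq0 => //; first exact: (arc_integrable fRe).
  by move=> n; case: (main x n).
have Im0 : \forall z \ae mu, Im (f z) = 0.
  apply: ae_circle_eq0 => //.
  apply: (@ae_eq0_initial_integrals (fun t => Im (f (cis t)))).
    exact: (arc_integrable fIm).
  move=> x xpi; apply: integral_initial_arc_eq0 => //; first exact: (arc_integrable fIm).
  by move=> n; case: (main x n).
by apply: filterS2 Re0 Im0 => z ? ?; exact: complex_ext.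
Qed.

Lemma ae_eq_of_fourier f g : L2 f -> L2 g ->
  (forall k, fourier f k = fourier g k) -> f =ae g.
Proof.
move=> fL gL fg; have := @fourier_eq0_ae (fun z => f z - g z) (LpB (le1_2 R) fL gL).
have d0 k : fourier (fun z => f z - g z) k = 0 by rewrite fourierB// fg subrr.
by move=> /(_ d0); apply: filterS => z /eqP; rewrite subr_eq0 => /eqP.
Qed.

End fourier_uniqueness.

(** * Scalar Hardy functions *)

Section hardy_scalar.
Variable R : realType.
Local Notation mu := (@arc_measure R).
Local Notation Re := complex.Re.
Local Notation Im := complex.Im.
Local Notation L2 := (@Lp R 2%:E).
Implicit Types (f g h w : circle R -> R[i]) (k : int).

(** The partial sums of h converge to some g with the Fourier coefficients of h,
    and g = h almost everywhere by uniqueness. *)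
Lemma H2_approx h : Hp 2%:E h ->
  forall e, 0 < e -> exists N, sqnorm (fun z => h z - partial_sum h N z) <= e.
Proof.
move=> [hL h0]; have [g [gL g1 g0 gC]] := riesz_projection hL.
have gh : g =ae h.
  apply: ae_eq_of_fourier => // k; have [/g1//|k0] := leP 0 k.
  by rewrite g0// h0.
move=> e /gC[N NP]; exists N; apply: le_trans NP; rewrite le_eqVlt; apply/orP; left.
have m2 f : L2 f -> measurable_fun setT (fun z => Re (f z) ^+ 2 + Im (f z) ^+ 2).
  by move=> [/Lfun_measurable ? /Lfun_measurable ?]; apply: measurable_funD; exact: measurable_funX.
apply/eqP/ae_eq_Rintegral.
- by apply: m2; apply: (LpB (le1_2 R)) => //; exact: L2_partial_sum.
- by apply: m2; apply: (LpB (le1_2 R)) => //; exact: L2_partial_sum.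
- by apply: filterS gh => z /[apply] ->.
Qed.

Lemma cdot_H2_eq0 d h : L2 d -> (forall k, 0 <= k -> fourier d k = 0) ->
  Hp 2%:E h -> cdot d h = 0.
Proof.
move=> dL d0 hH; have hL := hH.1.
suff hd : cdot h d = 0 by rewrite cdotC// hd conjc0.
apply: (cdot_small_eq0 dL) => e /(H2_approx hH)[N NP].
exists (fun z => h z - partial_sum h N z); first by apply: (LpB (le1_2 R)) => //; exact: L2_partial_sum.
split=> //; rewrite /partial_sum.
under eq_fun do rewrite -mulN1r.
rewrite cdotDl//; last by apply: (LpZ (le1_2 R)); exact: L2_partial_sum.
rewrite cdotZl//; last exact: L2_partial_sum.
have -> : cdot (partial_sum h N) d = 0.
  elim: N {NP} => [|N IH].
    rewrite /cdot -[RHS]Cintegral0; congr Cintegral; apply/funext => z.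
    by rewrite /partial_sum big_ord0 mul0r.
  have mL := @L2_monomial R N%:Z.
  rewrite partial_sumS cdotDl ?IH ?add0r//; [|exact: L2_partial_sum|exact: (LpZ (le1_2 R))].
  by rewrite cdotZl// cdotC// -fourierE d0// conjc0 mulr0.
by rewrite mulr0 addr0.
Qed.

(** The coefficient of w h at k < 0 is the product of h with conj(w) z^k, and h is
    a limit of analytic polynomials p, for which w p has no coefficient at k. *)
Lemma Hinf_mulH2 w h : Hp +oo%E w -> Hp 2%:E h -> Hp 2%:E (fun z => w z * h z).
Proof.
move=> [wL w0] hH; have hL := hH.1; split; first exact: Linf_mulL2.
move=> k k0; have wcL := LpJ wL; have mL := @L2_monomial R k.
apply: (@cdot_small_eq0 _ (fun z => conjc (w z) * monomial k z)).
  exact: Linf_mulL2.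
move=> e /(H2_approx hH)[N NP].
have pL := L2_partial_sum h N.
exists (fun z => h z - partial_sum h N z); first exact: (LpB (le1_2 R)).
split=> //.
have -> : cdot (fun z => h z - partial_sum h N z) (fun z => conjc (w z) * monomial k z) =
    fourier (fun z => w z * h z - w z * partial_sum h N z) k.
  rewrite fourierE; congr Cintegral; apply/funext => z.
  by rewrite rmorphM/= conjcK mulrA -mulrBr [w z * _]mulrC.
rewrite fourierB; [|exact: Linf_mulL2..].
suff -> : fourier (fun z => w z * partial_sum h N z) k = 0 by rewrite subr0.
have -> : (fun z => w z * partial_sum h N z) =
    (fun z => \sum_(i < N) fourier h i%:Z * (monomial i%:Z z * w z)).
  apply/funext => z; rewrite mulr_sumr; apply: eq_bigr => i _.
  by rewrite mulrCA [w z * _]mulrC.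
have wmL i : L2 (fun z => monomial i z * w z).
  by apply: Linf_mulL2; [exact: Linf_monomial|exact: Linf_L2].
rewrite fourier_sum => [|i]; last exact: (LpZ (le1_2 R)).
rewrite big1// => i _; rewrite fourierZ// fourier_monomialM w0 ?mulr0//.
by rewrite (le_lt_trans _ k0)// gerBl.
Qed.

Lemma fourier_cst (c : R[i]) k : fourier (cst c : circle R -> R[i]) k = (k == 0)%:R * c.
Proof.
have -> : (cst c : circle R -> R[i]) = (fun z => c * monomial 0 z).
  by apply/funext => z; rewrite /monomial expr0z mulr1.
by rewrite fourierZ ?fourier_monomial 1?mulrC//; exact: L2_monomial.
Qed.

Lemma Hp_cst p (c : R[i]) : (1 <= p)%E -> Hp p (cst c : circle R -> R[i]).
Proof.
move=> p1; split; first exact: Lp_cst.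
by move=> k k0; rewrite fourier_cst lt_eqF// mul0r.
Qed.

End hardy_scalar.

(** * Matrix-valued functions and their Fourier coefficients *)

Section matrix_symbols.
Variable R : realType.
Local Notation mu := (@arc_measure R).
Implicit Types (f g : circle R -> R[i]) (k : int).

Definition fourier_mx m n (F : circle R -> 'M[R[i]]_(m, n)) (k : int) : 'M[R[i]]_(m, n) :=
  \matrix_(i, j) fourier (fun z => F z i j) k.

Lemma LinfL2_mx m n (F : circle R -> 'M[R[i]]_(m, n)) : Linf F -> L2 F.
Proof. by move=> FL i j; exact: Linf_L2. Qed.

Lemma L2_mxD m n (F G : circle R -> 'M[R[i]]_(m, n)) : L2 F -> L2 G ->
  L2 (fun z => F z + G z).
Proof. by move=> FL GL i j; under eq_fun do rewrite mxE; exact: (LpD (le1_2 R)). Qed.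

Lemma L2_mxB m n (F G : circle R -> 'M[R[i]]_(m, n)) : L2 F -> L2 G ->
  L2 (fun z => F z - G z).
Proof. by move=> FL GL i j; under eq_fun do rewrite !mxE; exact: (LpB (le1_2 R)). Qed.

Lemma Linf_mulmx_L2 m n l (F : circle R -> 'M[R[i]]_(m, n))
    (G : circle R -> 'M[R[i]]_(n, l)) : Linf F -> L2 G -> L2 (fun z => F z *m G z).
Proof.
move=> FL GL i j; under eq_fun do rewrite mxE.
by apply: (Lp_sum _ (le1_2 R)) => a; exact: Linf_mulL2.
Qed.

Lemma Linf_mulmx m n l (F : circle R -> 'M[R[i]]_(m, n))
    (G : circle R -> 'M[R[i]]_(n, l)) : Linf F -> Linf G -> Linf (fun z => F z *m G z).
Proof.
move=> FL GL i j; under eq_fun do rewrite mxE.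
by apply: (Lp_sum _ (le1_oo R)) => a; exact: LinfM.
Qed.

Lemma Linf_mx_cst m n (D : 'M[R[i]]_(m, n)) : Linf (fun _ : circle R => D).
Proof. by move=> i j; apply: Lp_cst; exact: le1_oo. Qed.

Lemma L2_mulCmx m n l (D : 'M[R[i]]_(m, n)) (G : circle R -> 'M[R[i]]_(n, l)) :
  L2 G -> L2 (fun z => D *m G z).
Proof. by apply: Linf_mulmx_L2; exact: Linf_mx_cst. Qed.

Lemma H2_mxP m n (F : circle R -> 'M[R[i]]_(m, n)) :
  H2 F <-> L2 F /\ forall k, k < 0 -> fourier_mx F k = 0.
Proof.
split=> [FH|[FL F0] i j].
  by split=> [i j|k k0]; [case: (FH i j)|apply/matrixP => i j; rewrite !mxE (FH i j).2].
by split=> // k /F0 /matrixP /(_ i j); rewrite !mxE.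
Qed.

Lemma Hinf_mulmx_H2 m n l (F : circle R -> 'M[R[i]]_(m, n))
    (G : circle R -> 'M[R[i]]_(n, l)) : Hinf F -> H2 G -> H2 (fun z => F z *m G z).
Proof.
move=> FH GH i j; under eq_fun do rewrite mxE.
have H a : Hp 2%:E (fun z => F z i a * G z a j) by exact: Hinf_mulH2.
split=> [|k k0]; first by apply: (Lp_sum _ (le1_2 R)) => a; case: (H a).
rewrite fourier_sum => [|a]; last by case: (H a).
by rewrite big1// => a _; case: (H a) => _ ->.
Qed.

Lemma eq_fourier f g k : f =1 g -> fourier f k = fourier g k.
Proof. by move=> /funext ->. Qed.

Lemma fourier_mx_cst m n (D : 'M[R[i]]_(m, n)) k :
  fourier_mx (fun _ : circle R => D) k = (k == 0)%:R *: D.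
Proof. by apply/matrixP => i j; rewrite !mxE fourier_cst. Qed.

Lemma fourier_mxD m n (F G : circle R -> 'M[R[i]]_(m, n)) k : L2 F -> L2 G ->
  fourier_mx (fun z => F z + G z) k = fourier_mx F k + fourier_mx G k.
Proof.
move=> FL GL; apply/matrixP => i j; rewrite !mxE -fourierD//.
by apply: eq_fourier => z; rewrite mxE.
Qed.

Lemma fourier_mxB m n (F G : circle R -> 'M[R[i]]_(m, n)) k : L2 F -> L2 G ->
  fourier_mx (fun z => F z - G z) k = fourier_mx F k - fourier_mx G k.
Proof.
move=> FL GL; apply/matrixP => i j; rewrite !mxE -fourierB//.
by apply: eq_fourier => z; rewrite !mxE.
Qed.

Lemma fourier_mulCmx m n l (D : 'M[R[i]]_(m, n)) (G : circle R -> 'M[R[i]]_(n, l)) k :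
  L2 G -> fourier_mx (fun z => D *m G z) k = D *m fourier_mx G k.
Proof.
move=> GL; apply/matrixP => i j; rewrite !mxE.
under eq_fun do rewrite mxE; rewrite fourier_sum => [|a]; last exact: (LpZ (le1_2 R)).
by apply: eq_bigr => a _; rewrite fourierZ// mxE.
Qed.

Lemma fourier_mulmxC m n l (F : circle R -> 'M[R[i]]_(m, n)) (D : 'M[R[i]]_(n, l)) k :
  L2 F -> fourier_mx (fun z => F z *m D) k = fourier_mx F k *m D.
Proof.
move=> FL; apply/matrixP => i j; rewrite !mxE.
under eq_fun do [rewrite mxE; under eq_bigr do rewrite mulrC].
rewrite fourier_sum => [|a]; last exact: (LpZ (le1_2 R)).
by apply: eq_bigr => a _; rewrite fourierZ// mxE mulrC.
Qed.

Lemma fourier_mx_monomialZ m n (F : circle R -> 'M[R[i]]_(m, n)) l k :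
  fourier_mx (fun z => monomial l z *: F z) k = fourier_mx F (k - l).
Proof.
apply/matrixP => i j; rewrite !mxE -fourier_monomialM.
by apply: eq_fourier => z; rewrite mxE.
Qed.

Lemma L2_monomialZ m n (F : circle R -> 'M[R[i]]_(m, n)) l :
  L2 F -> L2 (fun z => monomial l z *: F z).
Proof.
move=> FL i j; under eq_fun do rewrite mxE.
by apply: Linf_mulL2 => //; exact: Linf_monomial.
Qed.

Lemma ae_eq_fourier_mx m n (F G : circle R -> 'M[R[i]]_(m, n)) k :
  L2 F -> L2 G -> F =ae G -> fourier_mx F k = fourier_mx G k.
Proof.
move=> FL GL FG; apply/matrixP => i j; rewrite !mxE.
apply: ae_eq_fourier; [exact: FL|exact: GL|].
by apply: filterS FG => z /[apply] ->.
Qed.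

Lemma ae_eq_of_fourier_mx m n (F G : circle R -> 'M[R[i]]_(m, n)) :
  L2 F -> L2 G -> (forall k, fourier_mx F k = fourier_mx G k) -> F =ae G.
Proof.
move=> FL GL FG.
have FG_entry (ij : 'I_m * 'I_n) : \forall z \ae mu, F z ij.1 ij.2 = G z ij.1 ij.2.
  case: ij => i j /=.
  have := @ae_eq_of_fourier _ (fun z => F z i j) (fun z => G z i j) (FL i j) (GL i j).
  have FGij k : fourier (fun z => F z i j) k = fourier (fun z => G z i j) k.
    by have /matrixP/(_ i j) := FG k; rewrite !mxE.
  by move=> /(_ FGij); apply: filterS => z; exact.
have FG_all : \forall z \ae mu, forall ij : 'I_m * 'I_n, F z ij.1 ij.2 = G z ij.1 ij.2.
  exact: filter_forall.
apply: filterS FG_all => z FGz _.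
by apply/matrixP => i j; exact: FGz (i, j).
Qed.

End matrix_symbols.

(** * Toeplitz and Hankel operators seen on Fourier coefficients *)

Section toeplitz_hankel.
Variables (R : realType) (n : nat).
Local Notation mu := (@arc_measure R).
Local Notation vfun := (circle R -> 'cV[R[i]]_n).
Local Notation mfun := (circle R -> 'M[R[i]]_n).
Implicit Types (f g h : vfun) (Phi Psi F : mfun) (k : int).

Lemma inner_cdot f h : L2 f -> L2 h ->
  inner f h = \sum_(i < n) cdot (fun z => f z i 0) (fun z => h z i 0).
Proof.
move=> fL hL; rewrite /inner Cintegral_sum// => i.
by apply: L2_mul_L1 => //; exact: LpJ.
Qed.

(** Testing against z^k e_i with k >= 0 reads off the coefficients; conversely
    a function with no coefficient of index k >= 0 is orthogonal to H^2 since
    analytic polynomials are dense there. *)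
Lemma is_H2_projP f g : L2 f -> is_H2_proj f g <->
  L2 g /\ forall k, fourier_mx g k = if 0 <= k then fourier_mx f k else 0.
Proof.
move=> fL; split=> [[gH fg]|[gL fg]].
- have [gL g0] := (H2_mxP g).1 gH.
  split=> // k; case: ifPn => [k0|]; last by rewrite -ltNge => /g0.
  apply/matrixP => i j; rewrite (ord1 j) !mxE.
  pose e : vfun := fun z => monomial k z *: delta_mx i 0.
  have eL : L2 e by apply: L2_monomialZ; exact/LinfL2_mx/Linf_mx_cst.
  have eH : H2 e.
    apply/H2_mxP; split=> // l l0.
    rewrite fourier_mx_monomialZ; apply/matrixP => a b; rewrite !mxE.
    apply: (Hp_cst _ (le1_2 R)).2.
    by rewrite (le_lt_trans _ l0)// gerBl.
  have := fg e eH; rewrite inner_cdot//; last exact: L2_mxB.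
  rewrite (bigD1 i)//= big1 ?addr0 => [|a ai].
    have -> : (fun z => e z i 0) = monomial k.
      by apply/funext => z; rewrite /e !mxE !eqxx mulr1.
    rewrite -fourierE.
    have -> : (fun z => (f - g) z i 0) = (fun z => f z i 0 - g z i 0).
      by apply/funext => z; rewrite !mxE.
    by rewrite fourierB// => /eqP; rewrite subr_eq0 => /eqP ->.
  rewrite /cdot -[RHS]Cintegral0; congr Cintegral; apply/funext => z.
  by rewrite /e !mxE (negPf ai) mulr0 conjc0 mulr0.
- split.
    apply/H2_mxP; split=> // k k0; rewrite fg ifF//.
    by apply/negbTE; rewrite -ltNge.
  move=> h hH; have [hL _] := (H2_mxP h).1 hH.
  rewrite inner_cdot//; last exact: L2_mxB.
  rewrite big1// => i _; apply: cdot_H2_eq0; last exact: hH.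
    by move: (L2_mxB fL gL i 0).
  move=> k k0; have := fourier_mxB k fL gL; rewrite fg k0 subrr.
  by move=> /matrixP /(_ i 0); rewrite !mxE.
Qed.

Lemma projP_fourier f : L2 f -> L2 (projP f) /\
  forall k, fourier_mx (projP f) k = if 0 <= k then fourier_mx f k else 0.
Proof.
move=> fL; apply/is_H2_projP => //.
rewrite /projP; apply: (@xgetPex _ (cst 0) [set g | is_H2_proj f g]).
have /choice[G GP] : forall i : 'I_n, exists g : circle R -> R[i],
    [/\ Lp 2%:E g, forall k, 0 <= k -> fourier g k = fourier (fun z => f z i 0) k &
      forall k, k < 0 -> fourier g k = 0].
  by move=> i; have [g [? ? ? _]] := riesz_projection (fL i 0); exists g.
exists (fun z => \col_i G i z); apply/is_H2_projP => //.
have E i : (fun z => (\col_i G i z) i 0) = G i.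
  by apply/funext => z; rewrite mxE.
split=> [i j|k]; first by rewrite (ord1 j) E; case: (GP i).
apply/matrixP => i j; rewrite (ord1 j) mxE E.
have [_ G1 G0] := GP i; case: ifPn => [/G1 ->|]; first by rewrite mxE.
by rewrite -ltNge => /G0 ->; rewrite mxE.
Qed.

Lemma L2_projP f : L2 f -> L2 (projP f).
Proof. by move=> /projP_fourier[]. Qed.

Lemma fourier_projP_ge0 f k : L2 f -> 0 <= k -> fourier_mx (projP f) k = fourier_mx f k.
Proof. by move=> /projP_fourier[_ ->] ->. Qed.

Lemma fourier_projP_lt0 f k : L2 f -> k < 0 -> fourier_mx (projP f) k = 0.
Proof. by move=> /projP_fourier[_ ->] k0; rewrite ifF//; apply/negbTE; rewrite -ltNge. Qed.

Lemma L2_projQ f : L2 f -> L2 (projQ f).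
Proof. by move=> fL; apply: L2_mxB => //; exact: L2_projP. Qed.

Lemma fourier_projQ f k : L2 f ->
  fourier_mx (projQ f) k = if 0 <= k then 0 else fourier_mx f k.
Proof.
move=> fL; have := fourier_mxB k fL (L2_projP fL); rewrite -/(projQ f) => ->.
by have [_ ->] := projP_fourier fL; case: ifP; rewrite ?subrr ?subr0.
Qed.

Lemma flipJ_ae_eq f g : flipJ f =ae flipJ g <-> f =ae g.
Proof.
split=> [fg|fg].
- have := ae_circle_conj fg; apply: filterS => z /(_ I) + _.
  rewrite /flipJ; have -> : circle_conj (circle_conj z) = z.
    by apply: val_inj; exact: conjcK.
  move=> /(congr1 (fun v => (conjc (circle_conj z : R[i]))^-1 *: v)).
  by rewrite !scalerA mulVf ?scale1r// conjc_eq0 circle_neq0.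
- have := ae_circle_conj fg; apply: filterS => z /(_ I) + _.
  by rewrite /flipJ => ->.
Qed.

Lemma projQ_ae_eq f g : L2 f -> L2 g ->
  (forall k, k < 0 -> fourier_mx f k = fourier_mx g k) -> projQ f =ae projQ g.
Proof.
move=> fL gL fg; apply: ae_eq_of_fourier_mx; [exact: L2_projQ|exact: L2_projQ|].
move=> k; apply: etrans (fourier_projQ k fL) _; apply/esym/(etrans (fourier_projQ k gL)).
by case: ifPn => //; rewrite -ltNge => /fg.
Qed.

(** The co-analytic part [projQ u] is determined by the coefficients of u of
    negative index, and [flipJ] loses no information. *)
Lemma hankel_eqP Phi f Psi g : Linf Phi -> L2 f -> Linf Psi -> L2 g ->
  hankel Phi f =ae hankel Psi g <->
  forall k, k < 0 -> fourier_mx (fun z => Phi z *m f z) k = fourier_mx (fun z => Psi z *m g z) k.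
Proof.
move=> PhiL fL PsiL gL.
have fL' := Linf_mulmx_L2 PhiL fL; have gL' := Linf_mulmx_L2 PsiL gL.
rewrite /hankel; split=> [/flipJ_ae_eq fg k k0|fg].
  have Q (u : vfun) (uL : L2 u) : fourier_mx (projQ u) k = fourier_mx u k.
    by apply: etrans (fourier_projQ k uL) _; rewrite leNgt k0.
  apply: etrans (esym (Q _ fL')) (etrans _ (Q _ gL')).
  exact: ae_eq_fourier_mx (L2_projQ fL') (L2_projQ gL') fg.
by apply/flipJ_ae_eq; exact: projQ_ae_eq.
Qed.

(** Here (Du, Dd) are the row blocks of an invertible matrix and (A, B) the column
    blocks of its inverse. For g = P(Psi h), the component Du g is the projection
    of Du Psi h = W1 h, which is already in H^2, while W2 Dd g lies in H^2. *)
Lemma hankel_toeplitz_split l r (Phi Psi : mfun)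
    (U1 : circle R -> 'M[R[i]]_(n, l)) (U2 : circle R -> 'M[R[i]]_(r, n))
    (W1 : circle R -> 'M[R[i]]_(l, n)) (W2 : circle R -> 'M[R[i]]_(n, r))
    (Du : 'M[R[i]]_(l, n)) (Dd : 'M[R[i]]_(r, n))
    (A : 'M[R[i]]_(n, l)) (B : 'M[R[i]]_(n, r)) :
  Linf Phi -> Linf Psi -> Linf U1 -> Linf U2 -> Hinf W1 -> Hinf W2 ->
  Du *m A = 1%:M -> Du *m B = 0 ->
  Phi =ae (fun z => U1 z *m Du + W2 z *m Dd) ->
  Psi =ae (fun z => A *m W1 z + B *m U2 z) ->
  eq_on_H2 (hankel Phi \o toeplitz Psi) (hankel (fun z => U1 z *m W1 z)).
Proof.
move=> PhiL PsiL U1L U2L W1H W2H DA DB PhiE PsiE h hH /=.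
have [hL h0] := (H2_mxP h).1 hH.
have W1L : Linf W1 by move=> i j; case: (W1H i j).
have W2L : Linf W2 by move=> i j; case: (W2H i j).
have PsihL : L2 (mulop Psi h) by exact: Linf_mulmx_L2.
set g := toeplitz Psi h.
have gL : L2 g by exact: L2_projP.
have gH : H2 g.
  by apply/H2_mxP; split=> // k k0; rewrite fourier_projP_lt0.
have W1hH := Hinf_mulmx_H2 W1H hH; have [W1hL W1h0] := (H2_mxP _).1 W1hH.
have top : (fun z => Du *m g z) =ae (fun z => W1 z *m h z).
  apply: ae_eq_of_fourier_mx => //; first exact: L2_mulCmx.
  move=> k; rewrite fourier_mulCmx//; have [k0|k0] := leP 0 k; last first.
    by rewrite fourier_projP_lt0// mulmx0 W1h0.
  rewrite fourier_projP_ge0// -fourier_mulCmx//.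
  apply: ae_eq_fourier_mx => //; first exact: L2_mulCmx.
  apply: filterS PsiE => z /(_ I) PsiE _; rewrite /mulop PsiE mulmxA mulmxDr !mulmxA.
  by rewrite DA DB mul1mx mul0mx addr0.
apply/hankel_eqP => //; first exact: Linf_mulmx.
move=> k k0.
have bH : H2 (fun z => W2 z *m (Dd *m g z)).
  apply: Hinf_mulmx_H2 => //; apply: Hinf_mulmx_H2 => // i j.
  by apply: Hp_cst; exact: le1_oo.
have [bL b0] := (H2_mxP _).1 bH.
have U1W1hL : L2 (fun z => U1 z *m W1 z *m h z).
  by apply: Linf_mulmx_L2 => //; exact: Linf_mulmx.
rewrite -[RHS]addr0 -(b0 k k0) -fourier_mxD//.
apply: ae_eq_fourier_mx; [exact: Linf_mulmx_L2|exact: L2_mxD|].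
apply: filterS2 PhiE top => z /(_ I) PhiE /(_ I) topE _.
by rewrite PhiE mulmxDl -!mulmxA topE.
Qed.

(** The functions g m and g m.+1 below are P(Psi h) and P(z Psi h) for
    h = z^m v. Their images under Phi have negative coefficients which are shifts of
    each other, while g m.+1 = z g m + c with c = Psi^(-m-1) v. *)
Lemma block_hankel_fourier Phi Psi : Linf Phi -> Linf Psi ->
  is_block_hankel (hankel Phi \o toeplitz Psi) ->
  forall k l, k < 0 -> l < 0 -> fourier_mx Phi k *m fourier_mx Psi l = 0.
Proof.
move=> PhiL PsiL [F FL HF] k l k0 l0.
suff main (v : 'cV[R[i]]_n) : fourier_mx Phi k *m (fourier_mx Psi l *m v) = 0.
  apply/matrixP => i j; have /matrixP/(_ i 0) := main (delta_mx j 0).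
  by rewrite mulmxA -colE !mxE.
have PhiL2 := LinfL2_mx PhiL; have PsiL2 := LinfL2_mx PsiL; have FL2 := LinfL2_mx FL.
pose h (m : nat) : vfun := fun z => monomial m z *: v.
have vL : L2 (fun _ : circle R => v) by exact/LinfL2_mx/Linf_mx_cst.
have hL m : L2 (h m) by exact: L2_monomialZ.
have hH m : H2 (h m).
  apply/H2_mxP; split=> // j j0; rewrite fourier_mx_monomialZ.
  apply/matrixP => a b; rewrite !mxE; apply: (Hp_cst _ (le1_2 R)).2.
  by rewrite (le_lt_trans _ j0)// gerBl.
have fourier_mulh (G : mfun) m j : L2 G ->
    fourier_mx (fun z => G z *m h m z) j = fourier_mx G (j - m%:Z) *m v.
  move=> GL; rewrite -fourier_mulmxC// -fourier_mx_monomialZ.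
  by congr fourier_mx; apply/funext => z; rewrite /h -scalemxAr.
pose g m := toeplitz Psi (h m).
have PsihL m : L2 (mulop Psi (h m)) by exact: Linf_mulmx_L2.
have gL m : L2 (g m) by exact: L2_projP.
have Hg m j : j < 0 ->
    fourier_mx (fun z => Phi z *m g m z) j = fourier_mx F (j - m%:Z) *m v.
  move=> j0; rewrite -fourier_mulh//.
  by apply: (hankel_eqP PhiL (gL m) FL (hL m)).1 => //; exact: HF.
have g_ge0 m j : 0 <= j -> fourier_mx (g m) j = fourier_mx Psi (j - m%:Z) *m v.
  move=> j0; apply: etrans (fourier_projP_ge0 (PsihL m) j0) _.
  exact: fourier_mulh.
have g_lt0 m j : j < 0 -> fourier_mx (g m) j = 0.
  by move=> j0; exact: fourier_projP_lt0 (PsihL m) j0.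
(* From here on only the coefficients of g matter. *)
clearbody g.
case: l l0 => // m _; rewrite NegzE.
pose c := fourier_mx Psi (- m.+1%:Z) *m v.
have cL : L2 (fun _ : circle R => c) by exact/LinfL2_mx/Linf_mx_cst.
have zgL : L2 (fun z => monomial 1 z *: g m z) by exact: L2_monomialZ.
have gS : g m.+1 =ae (fun z => monomial 1 z *: g m z + c).
  apply: ae_eq_of_fourier_mx; [exact: gL|exact: L2_mxD|move=> j].
  rewrite fourier_mxD// fourier_mx_monomialZ.
  rewrite fourier_mx_cst; have [->|j0] := eqVneq j 0.
    by rewrite g_ge0// g_lt0// !add0r scale1r.
  rewrite scale0r addr0; have [j1|j1] := ltP j 0.
    rewrite !g_lt0//.
    by rewrite (lt_trans _ j1)// gtrBl.
  have j2 : 0 <= j - 1.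
    by rewrite subr_ge0 -gtz0_ge1 lt_neqAle eq_sym j0 j1.
  rewrite !g_ge0//.
  by congr (fourier_mx _ _ *m _); rewrite -addrA -opprD -intS.
have := Hg m.+1 k k0.
have -> : fourier_mx (fun z => Phi z *m g m.+1 z) k =
    fourier_mx (fun z => Phi z *m (monomial 1 z *: g m z) + Phi z *m c) k.
  apply: ae_eq_fourier_mx.
  - exact: Linf_mulmx_L2.
  - by apply: L2_mxD; exact: Linf_mulmx_L2.
  - by apply: filterS gS => z /[apply] ->; rewrite mulmxDr.
rewrite fourier_mxD; [|exact: Linf_mulmx_L2..].
rewrite fourier_mulmxC//.
have -> : (fun z => Phi z *m (monomial 1 z *: g m z)) =
    (fun z => monomial 1 z *: (Phi z *m g m z)).
  by apply/funext => z; rewrite -scalemxAr.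
rewrite fourier_mx_monomialZ Hg; last by rewrite (lt_trans _ k0)// gtrBl.
rewrite -addrA -opprD -intS.
move=> E; apply: (addrI (fourier_mx F (k - m.+1%:Z) *m v)).
by rewrite addr0; exact: E.
Qed.

End toeplitz_hankel.

(** * A basis adapted to two families of matrices *)

Section annihilators.
Variables (F : fieldType) (n : nat) (J : Type).

(** Among the matrices that annihilate the family on the left, one of maximal rank
    works: the sum of its row space with that of another one is again that of an
    annihilating matrix. *)
Lemma maximal_left_annihilator (b : J -> 'M[F]_n) : exists K : 'M[F]_n,
  (forall j, K *m b j = 0) /\
  forall A : 'M[F]_n, (forall j, A *m b j = 0) -> (A <= K)%MS.
Proof.
pose P r := `[< exists K : 'M[F]_n, (forall j, K *m b j = 0) /\ \rank K = r >].
have P0 : exists r, P r.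
  by exists 0%N; apply/asboolP; exists 0; split=> [j|]; rewrite ?mul0mx ?mxrank0.
have Pn r : P r -> (r <= n)%N.
  by move=> /asboolP[K [_ <-]]; exact: rank_leq_row.
have [r /asboolP[K [Kb Kr]] rmax] := ex_maxnP P0 Pn.
exists K; split=> // A Ab.
have KA : (K <= K + A)%MS by exact: addsmxSl.
have KAb j : (K + A)%MS *m b j = 0.
  apply/sub_kermxP; rewrite addsmx_sub; apply/andP; split; exact/sub_kermxP.
have rKA : (\rank (K + A)%MS <= \rank K)%N.
  by rewrite Kr; apply: rmax; apply/asboolP; exists (K + A)%MS.
have := mxrank_leqif_sup KA; rewrite /leqif => -[le_r eq_r].
move: eq_r; rewrite eqn_leq le_r rKA /= => /esym KAK.
exact: submx_trans (addsmxSr K A) KAK.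
Qed.

Lemma pid_mxE_ge r (A : 'M[F]_n) i (j : 'I_n) : (r <= j)%N -> (A *m pid_mx r : 'M[F]_n) i j = 0.
Proof.
move=> rj; rewrite mxE big1// => a _; rewrite !mxE.
case: eqP => [ja|]; last by rewrite mulr0.
by rewrite ja ltnNge rj mulr0.
Qed.

Lemma pid_mxE_lt r (A : 'M[F]_n) (i : 'I_n) j : (i < r)%N -> (pid_mx r *m A : 'M[F]_n) i j = A i j.
Proof.
move=> ir; rewrite mxE (bigD1 i)//= big1 ?addr0 => [|a ai]; rewrite !mxE.
  by rewrite eqxx ir mul1r.
by rewrite (_ : _ == _ = false) ?mul0r// eq_sym; exact/negbTE.
Qed.

(** Let K be the annihilator given by [maximal_left_annihilator]. The first rows of
    its extended row basis D span the row space of K, where all the rows of the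
    matrices a i must lie. *)
Lemma adapted_basis (I : Type) (a : I -> 'M[F]_n) (b : J -> 'M[F]_n) :
  (forall i j, a i *m b j = 0) ->
  exists (D : 'M[F]_n) (l : nat), [/\ D \in unitmx, (l <= n)%N,
    forall x (r c : 'I_n), (r < l)%N -> (D *m b x) r c = 0 &
    forall x (r c : 'I_n), (l <= c)%N -> (a x *m invmx D) r c = 0].
Proof.
move=> ab; have [K [Kb Kmax]] := maximal_left_annihilator b.
exists (row_ebase K), (\rank K); split=> //.
- exact: row_ebase_unit.
- exact: rank_leq_row.
- move=> x r c rl; rewrite -(pid_mxE_lt _ _ rl) mulmxA.
  have -> : pid_mx (\rank K) *m row_ebase K = invmx (col_ebase K) *m K.
    by apply: (canRL (mulKmx (col_ebase_unit K))); rewrite mulmxA mulmx_ebase.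
  by rewrite -mulmxA Kb mulmx0 mxE.
- move=> x r c lc; have /submxP[S ->] := Kmax (a x) (ab x).
  rewrite -mulmxA -[X in X *m invmx _](mulmx_ebase K) mulmxK ?row_ebase_unit// mulmxA.
  exact: pid_mxE_ge.
Qed.

End annihilators.

Section castmx_mul.
Variable K : fieldType.

Lemma mul_castmx_col m n l p (e : n = l) (A : 'M[K]_(m, n)) (B : 'M[K]_(l, p)) :
  castmx (erefl m, e) A *m B = A *m castmx (esym e, erefl p) B.
Proof. by case: l / e B => B; rewrite !castmx_id. Qed.

Lemma mul_castmx_row m n l p (e : n = l) (A : 'M[K]_(m, l)) (B : 'M[K]_(n, p)) :
  A *m castmx (e, erefl p) B = castmx (erefl m, esym e) A *m B.
Proof. by case: l / e A => A; rewrite !castmx_id. Qed.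

End castmx_mul.

(** * Splittings of the pair of symbols *)

Section splitting.
Variables (R : realType) (n : nat).
Implicit Types (Phi Psi : circle R -> 'M[R[i]]_n).

(** The casts are moved from the symbols to D and its inverse, whose blocks are then
    the matrices Du, Dd and A, B of [hankel_toeplitz_split]. *)
Lemma splits_hankel Phi Psi (D : 'M[R[i]]_n) (l : nat) (le_ln : (l <= n)%N)
    (U1 : circle R -> 'M[R[i]]_(n, l)) (U2 : circle R -> 'M[R[i]]_(n - l, n))
    (W1 : circle R -> 'M[R[i]]_(l, n)) (W2 : circle R -> 'M[R[i]]_(n, n - l)) :
  Linf Phi -> Linf Psi -> splits Phi Psi D le_ln U1 U2 W1 W2 ->
  eq_on_H2 (hankel Phi \o toeplitz Psi) (hankel (fun z => U1 z *m W1 z)).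
Proof.
move=> PhiL PsiL [Du [U1L U2L W1H W2H] PhiE PsiE].
pose e := subnKC le_ln.
pose D' := castmx (esym e, erefl n) D.
pose E' := castmx (erefl n, esym e) (invmx D).
have DE : D' *m E' = 1%:M.
  rewrite /D' /E'; case: _ / (esym e); rewrite !castmx_id.
  exact: mulmxV.
have [DuA DuB] : usubmx D' *m lsubmx E' = 1%:M /\ usubmx D' *m rsubmx E' = 0.
  move: DE; rewrite -{1}(vsubmxK D') -{1}(hsubmxK E') mul_col_row.
  by rewrite scalar_mx_block => /eq_block_mx[].
apply: (hankel_toeplitz_split PhiL PsiL U1L U2L W1H W2H DuA DuB (Dd := dsubmx D')).
- apply: filterS PhiE => z /[apply] ->.
  by rewrite mul_castmx_col -/D' -{1}(vsubmxK D') mul_row_col.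
- apply: filterS PsiE => z /[apply] ->.
  by rewrite mul_castmx_row -/E' -{1}(hsubmxK E') mul_row_col.
Qed.

Lemma splits_of_fourier Phi Psi : Linf Phi -> Linf Psi ->
  (forall k l, k < 0 -> l < 0 -> fourier_mx Phi k *m fourier_mx Psi l = 0) ->
  exists (D : 'M[R[i]]_n) (l : nat) (le_ln : (l <= n)%N)
    (U1 : circle R -> 'M[R[i]]_(n, l)) (U2 : circle R -> 'M[R[i]]_(n - l, n))
    (W1 : circle R -> 'M[R[i]]_(l, n)) (W2 : circle R -> 'M[R[i]]_(n, n - l)),
  splits Phi Psi D le_ln U1 U2 W1 W2.
Proof.
move=> PhiL PsiL PhiPsi.
have [D [l [Du le_ln DPsi PhiD]]] := adapted_basis
  (fun i j : {k : int | k < 0} => PhiPsi (val i) (val j) (valP i) (valP j)).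
pose e := subnKC le_ln.
pose Phi' z := castmx (erefl n, esym e) (Phi z *m invmx D).
pose Psi' z := castmx (esym e, erefl n) (D *m Psi z).
have PhiDL : Linf (fun z => Phi z *m invmx D).
  by apply: Linf_mulmx => //; exact: Linf_mx_cst.
have DPsiL : Linf (fun z => D *m Psi z).
  by apply: Linf_mulmx => //; exact: Linf_mx_cst.
exists D, l, le_ln, (fun z => lsubmx (Phi' z)), (fun z => dsubmx (Psi' z)),
  (fun z => usubmx (Psi' z)), (fun z => rsubmx (Phi' z)).
have Phi'E z i j : Phi' z i j = (Phi z *m invmx D) i (cast_ord e j).
  by rewrite castmxE /= cast_ord_id esymK.
have Psi'E z i j : Psi' z i j = (D *m Psi z) (cast_ord e i) j.
  by rewrite castmxE /= cast_ord_id esymK.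
split=> //.
- split=> i j.
  + by under eq_fun do rewrite mxE Phi'E; exact: PhiDL.
  + by under eq_fun do rewrite mxE Psi'E; exact: DPsiL.
  + under eq_fun do rewrite mxE Psi'E; split; first exact: DPsiL.
    move=> k k0; have := DPsi (exist _ k k0) (cast_ord e (lshift _ i)) j (ltn_ord i).
    by rewrite -fourier_mulCmx ?mxE//; exact: LinfL2_mx.
  + under eq_fun do rewrite mxE Phi'E; split; first exact: PhiDL.
    move=> k k0; have := PhiD (exist _ k k0) i (cast_ord e (rshift _ j)) (leq_addr _ _).
    by rewrite -fourier_mulmxC ?mxE//; exact: LinfL2_mx.
- apply: aeW => z _; rewrite hsubmxK /Phi'.
  by rewrite (castmxKV (erefl n) e) mulmxKV.
- apply: aeW => z _; rewrite vsubmxK /Psi'.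
  by rewrite (castmxKV e (erefl n)) mulKmx.
Qed.

End splitting.

Theorem theorem2p17 (R : realType) (n : nat) (n_gt0 : (0 < n)%N)
    (Phi Psi : circle R -> 'M[R[i]]_n) (LPhi : Linf Phi) (LPsi : Linf Psi) :
  (is_block_hankel (hankel Phi \o toeplitz Psi) <->
   exists (D : 'M[R[i]]_n) (l : nat) (le_ln : (l <= n)%N)
          (U1 : circle R -> 'M[R[i]]_(n, l))
          (U2 : circle R -> 'M[R[i]]_(n - l, n))
          (W1 : circle R -> 'M[R[i]]_(l, n))
          (W2 : circle R -> 'M[R[i]]_(n, n - l)),
     splits Phi Psi D le_ln U1 U2 W1 W2) /\
  (forall (D : 'M[R[i]]_n) (l : nat) (le_ln : (l <= n)%N)
          (U1 : circle R -> 'M[R[i]]_(n, l))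
          (U2 : circle R -> 'M[R[i]]_(n - l, n))
          (W1 : circle R -> 'M[R[i]]_(l, n))
          (W2 : circle R -> 'M[R[i]]_(n, n - l)),
     splits Phi Psi D le_ln U1 U2 W1 W2 ->
     eq_on_H2 (hankel Phi \o toeplitz Psi)
              (hankel (fun z => U1 z *m W1 z))).
Proof.
split; last by move=> D l le_ln U1 U2 W1 W2 sp; exact: splits_hankel sp.
split=> [bh|[D [l [le_ln [U1 [U2 [W1 [W2 sp]]]]]]]].
  by apply: splits_of_fourier => //; exact: block_hankel_fourier.
exists (fun z => U1 z *m W1 z); last exact: splits_hankel sp.
case: sp => _ [U1L _ W1H _] _ _; apply: Linf_mulmx => // i j.
by case: (W1H i j).
Qed.
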